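(* Let $\mathfrak{g}_{2|4}^{3}(\lambda)$ ($\lambda\in\mathbb{C}$, $\lambda\ne0$) and $\mathfrak{g}_{2|4}^{4}$ be the complex Lie superalgebras of dimension $2|4$ with basis $\{e_1,e_2\mid e_3,e_4,e_5,e_6\}$ ($e_1,e_2$ even, $e_3,\dots,e_6$ odd) and nontrivial brackets \begin{align*} \mathfrak{g}_{2|4}^{3}(\lambda):\ &[e_2,e_3]=e_3,\ [e_2,e_4]=\lambda e_4,\ [e_2,e_5]=-e_5,\ [e_2,e_6]=-\lambda e_6,\ [e_3,e_5]=e_1,\ [e_4,e_6]=\lambda e_1;\\ \mathfrak{g}_{2|4}^{4}:\ &[e_2,e_3]=e_3,\ [e_2,e_4]=e_3+e_4,\ [e_2,e_5]=-e_5-e_6,\ [e_2,e_6]=-e_6,\ [e_3,e_5]=[e_4,e_5]=[e_4,e_6]=e_1. \end{align*} Metric deformations of the family $\mathfrak{g}_{2|4}^{3}(\lambda)$ $(\lambda\neq0)$ are the following: (1) If $\lambda\neq\pm1$, then $\mathfrak{g}_{2|4}^{3}(\lambda)$ has only one (nontrivial) metric deformation, up to equivalence and change of parameter, and it is a smooth deformation to the family $\mathfrak{g}_{2|4}^{3}(\lambda)$ around itself. (2) The special element $\mathfrak{g}_{2|4}^{3}(1)\overset{i}{\simeq}\mathfrak{g}_{2|4}^{3}(-1)$ has a smooth metric deformation to the family $\mathfrak{g}_{2|4}^{3}(\lambda)$ around itself, and it has a jump metric deformation to $\mathfrak{g}_{2|4}^{4}$.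
   Context: All Lie superalgebras are over $\mathbb{C}$. Brackets of basis elements that are not listed are zero or determined by $[y,x]=-(-1)^{|x||y|}[x,y]$. A metric Lie superalgebra is a Lie superalgebra together with an even, non-degenerate, supersymmetric bilinear form $B$ (an invariant scalar product) that is invariant: $B([x,y],z)=B(x,[y,z])$. The notation $\overset{i}{\simeq}$ means isometrically isomorphic: there is a Lie superalgebra isomorphism preserving the (suitable) invariant scalar products, i.e. $B'(f(x),f(y))=B(x,y)$. A formal 1-parameter deformation of a Lie superalgebra $(\mathfrak g,[\ ,\ ])$ is a $\mathbb{C}[[t]]$-bilinear Lie superalgebra structure on $\mathfrak g[[t]]=\mathfrak g\otimes_{\mathbb C}\mathbb{C}[[t]]$ of the form $[\ ,\ ]_t=[\ ,\ ]+\sum_{i\ge1}t^i\phi_i$, each $\phi_i:\mathfrak g\times\mathfrak g\to\mathfrak g$ being an even super-skew-symmetric bilinear map. Two such deformations $[\ ,\ ]_t,[\ ,\ ]'_t$ are equivalent if there is $\widehat\psi_t=\mathrm{id}+\psi_1t+\psi_2t^2+\cdots$ with even linear $\psi_i:\mathfrak g\to\mathfrak g$ and $\widehat\psi_t([x,y]_t)=[\widehat\psi_t(x),\widehat\psi_t(y)]'_t$ for all $x,y\in\mathfrak g$. A deformation is trivial if it is equivalent to the original bracket. A metric deformation is a formal 1-parameter deformation that defines a metric Lie superalgebra, i.e. $(\mathfrak g[[t]],[\ ,\ ]_t)$ admits an even, supersymmetric, invariant $\mathbb{C}[[t]]$-bilinear form that is non-degenerate over $\mathbb{C}[[t]]$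 (induces an isomorphism with the dual module). A deformation is a jump deformation to $\mathfrak h$ if for every non-zero value of $t$ near the origin it gives an algebra isomorphic to the same Lie superalgebra $\mathfrak h$, which is not isomorphic to $\mathfrak g$. It is smooth if for different non-zero values of $t$ near the origin it defines non-isomorphic algebras (coincidences caused by symmetry being allowed). It is a smooth deformation to a family $\mathfrak h(\lambda)$ around $\lambda_0$ (around itself, if $\mathfrak g=\mathfrak h(\lambda_0)$) if it is smooth and for non-zero $t$ near the origin it is isomorphic to $\mathfrak h(\lambda(t))$ with $\lambda(t)\to\lambda_0$ as $t\to0$. *)

(* Defs.v *)
From HB Require Import structures.
From mathcomp Require Import all_boot all_order all_algebra.
From mathcomp Require Import boolp classical_sets reals topology normedtype.
From mathcomp Require Import sequences.
From mathcomp Require Export complex.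

Set Implicit Arguments.
Unset Strict Implicit.
Unset Printing Implicit Defensive.

Import Order.TTheory GRing.Theory Num.Theory.
Import numFieldNormedType.Exports.

Local Open Scope ring_scope.
Local Open Scope complex_scope.
Local Open Scope classical_set_scope.

(** * Formal power series *)

(* [Fps f] stands for the series \sum_n f(n) t^n; the wrapper keeps the Cauchy
   product apart from the pointwise product carried by [nat -> K]. *)
Record fps (K : Type) := Fps { fpscoef : nat -> K }.

Lemma fpsP (K : Type) (f g : fps K) : fpscoef f =1 fpscoef g -> f = g.
Proof. by case: f g => f [g] /= /funext ->. Qed.

HB.instance Definition _ (K : Type) := gen_eqMixin (fps K).
HB.instance Definition _ (K : Type) := gen_choiceMixin (fps K).

Section FpsRing.
Variable K : comNzRingType.
Implicit Types f g h : fps K.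

Definition fpsC (a : K) : fps K := Fps (fun n => if n == 0%N then a else 0).

Definition fps_add f g := Fps (fun n => fpscoef f n + fpscoef g n).
Definition fps_opp f := Fps (fun n => - fpscoef f n).
Definition fps_mul f g :=
  Fps (fun n => \sum_(i < n.+1) fpscoef f i * fpscoef g (n - i)%N).

Fact fps_addA : associative fps_add.
Proof. by move=> f g h; apply: fpsP => n /=; rewrite addrA. Qed.
Fact fps_addC : commutative fps_add.
Proof. by move=> f g; apply: fpsP => n /=; rewrite addrC. Qed.
Fact fps_add0 : left_id (fpsC 0) fps_add.
Proof. by move=> f; apply: fpsP => n /=; rewrite if_same add0r. Qed.
Fact fps_addN : left_inverse (fpsC 0) fps_opp fps_add.
Proof. by move=> f; apply: fpsP => n /=; rewrite if_same addNr. Qed.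

HB.instance Definition _ :=
  GRing.isZmodule.Build (fps K) fps_addA fps_addC fps_add0 fps_addN.

Let trunc N f : {poly K} := \poly_(i < N) fpscoef f i.

Let trunc_mul N f g n : (n < N)%N ->
  fpscoef (fps_mul f g) n = (trunc N f * trunc N g)`_n.
Proof.
move=> nN; rewrite coefM /=; apply: eq_bigr => i _; rewrite !coef_poly.
by rewrite !(leq_ltn_trans _ nN) ?leq_subr// -ltnS ltn_ord.
Qed.

Let trunc_coef N f n : (n < N)%N -> fpscoef f n = (trunc N f)`_n.
Proof. by move=> nN; rewrite coef_poly nN. Qed.

Fact fps_mulA : associative fps_mul.
Proof.
move=> f g h; apply: fpsP => n.
transitivity ((trunc n.+1 f * (trunc n.+1 g * trunc n.+1 h))`_n).
  rewrite /= coefM; apply: eq_bigr => i _.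
  by rewrite -trunc_coef ?ltn_ord// -trunc_mul// ltnS leq_subr.
rewrite mulrA /= coefM; apply: eq_bigr => i _.
by rewrite -trunc_mul ?ltn_ord// -trunc_coef// ltnS leq_subr.
Qed.

Fact fps_mulC : commutative fps_mul.
Proof.
by move=> f g; apply: fpsP => n; rewrite !(@trunc_mul n.+1)// mulrC.
Qed.

Fact fps_mul1 : left_id (fpsC 1) fps_mul.
Proof.
move=> f; apply: fpsP => n /=.
by rewrite big_ord_recl /= subn0 mul1r big1 ?addr0// => i _; rewrite mul0r.
Qed.

Fact fps_mulDl : left_distributive fps_mul fps_add.
Proof.
move=> f g h; apply: fpsP => n /=; rewrite -big_split /=.
by apply: eq_bigr => i _; rewrite mulrDl.
Qed.

Fact fps_one_neq0 : fpsC 1 != fpsC 0.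
Proof.
apply/eqP => /(congr1 (fun f : fps K => fpscoef f 0%N)) /= /eqP.
by rewrite oner_eq0.
Qed.

HB.instance Definition _ := GRing.Zmodule_isComNzRing.Build (fps K)
  fps_mulA fps_mulC fps_mul1 fps_mulDl fps_one_neq0.

(* f(u(t)), meaningful when u has zero constant term: the terms u^i with i > n
   then do not contribute to the coefficient of t^n. *)
Definition fps_comp f (u : fps K) : fps K :=
  Fps (fun n => \sum_(i < n.+1) fpscoef f i * fpscoef (u ^+ i) n).

End FpsRing.

(** * Metric Lie superalgebras on a free module of rank m|n *)

Section LieSuper.
Variables (m n : nat) (A : comNzRingType).

Local Notation V := 'rV[A]_(m + n).

Definition bvec (i : 'I_(m + n)) : V := delta_mx 0 i.

(* The first m basis vectors are even, the last n are odd. *)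
Definition parity (i : 'I_(m + n)) : bool := (m <= i)%N.

Definition homog (p : bool) (x : V) : Prop :=
  forall i, parity i != p -> x 0 i = 0.

Definition bilinear_op (br : V -> V -> V) : Prop :=
  (forall x, linear (br x)) /\ (forall y, linear (br^~ y)).

Record lie_superalgebra (br : V -> V -> V) : Prop := LieSuperalgebra {
  ls_bilinear : bilinear_op br;
  ls_even : forall p q x y,
    homog p x -> homog q y -> homog (p (+) q) (br x y);
  ls_skew : forall p q x y, homog p x -> homog q y ->
    br y x = - ((-1) ^+ (p && q) *: br x y);
  ls_jacobi : forall p q x y z, homog p x -> homog q y ->
    br x (br y z) = br (br x y) z + (-1) ^+ (p && q) *: br y (br x z) }.

(* Non-degeneracy over A: x |-> B(x, -) is a bijection onto the dual module. *)
Record invariant_scalar_product (br : V -> V -> V) (B : V -> V -> A) : Prop :=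
  InvariantScalarProduct {
  isp_linearr : forall x, scalar (B x);
  isp_linearl : forall y, scalar (B^~ y);
  isp_even : forall p q x y, homog p x -> homog q y -> p != q -> B x y = 0;
  isp_supersym : forall p q x y, homog p x -> homog q y ->
    B y x = (-1) ^+ (p && q) * B x y;
  isp_nondeg : forall f : {scalar V}, exists! x, forall y, B x y = f y;
  isp_invariant : forall x y z, B (br x y) z = B x (br y z) }.

Definition metric_lie_superalgebra (br : V -> V -> V) : Prop :=
  lie_superalgebra br /\ exists B, invariant_scalar_product br B.

Record lie_hom (br br' : V -> V -> V) (f : V -> V) : Prop := LieHom {
  lh_linear : linear f;
  lh_even : forall p x, homog p x -> homog p (f x);
  lh_bracket : forall x y, f (br x y) = br' (f x) (f y) }.

Definition lie_isomorphic (br br' : V -> V -> V) : Prop :=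
  exists2 f, lie_hom br br' f & bijective f.

Definition isometrically_isomorphic (br br' : V -> V -> V) : Prop :=
  exists B B' f, [/\ invariant_scalar_product br B,
    invariant_scalar_product br' B', lie_hom br br' f, bijective f
    & forall x y, B' (f x) (f y) = B x y].

Definition entry (i j : nat) (v : V) : nat * nat * V := (i, j, v).

(* The bracket listed by T: entry i j v, with i, j counted from 1 and
   i <> j, means [e_i, e_j] = v and [e_j, e_i] = -(-1)^{|e_i||e_j|} v; the
   pairs of basis vectors that do not occur have bracket 0. *)
Definition table_bracket (idx : nat -> 'I_(m + n)) (T : seq (nat * nat * V))
    (x y : V) : V :=
  \sum_(e <- T) let i := idx e.1.1 in let j := idx e.1.2 in
    (x 0 i * y 0 j - (-1) ^+ (parity i && parity j) * (x 0 j * y 0 i)) *: e.2.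

End LieSuper.

(* The A'-bilinear bracket whose structure constants are the images under f of
   those of br. *)
Definition map_bracket (m n : nat) (A A' : comNzRingType) (f : A -> A')
    (br : 'rV[A]_(m + n) -> 'rV[A]_(m + n) -> 'rV[A]_(m + n))
    (x y : 'rV[A']_(m + n)) : 'rV[A']_(m + n) :=
  \sum_i \sum_j (x 0 i * y 0 j) *: map_mx f (br (bvec A i) (bvec A j)).

(** * The superalgebras of dimension 2|4 *)

Section Examples.
Variable A : comNzRingType.

Definition idx6 (k : nat) : 'I_(2 + 4) := inord k.-1.
Definition e_ (k : nat) : 'rV[A]_(2 + 4) := bvec A (idx6 k).

Definition g3_2_4 (l : A) : 'rV[A]_(2 + 4) -> 'rV[A]_(2 + 4) -> 'rV[A]_(2 + 4) :=
  table_bracket idx6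
    [:: entry 2 3 (e_ 3); entry 2 4 (l *: e_ 4);
        entry 2 5 (- e_ 5); entry 2 6 (- (l *: e_ 6));
        entry 3 5 (e_ 1); entry 4 6 (l *: e_ 1)].

Definition g4_2_4 : 'rV[A]_(2 + 4) -> 'rV[A]_(2 + 4) -> 'rV[A]_(2 + 4) :=
  table_bracket idx6
    [:: entry 2 3 (e_ 3); entry 2 4 (e_ 3 + e_ 4);
        entry 2 5 (- e_ 5 - e_ 6); entry 2 6 (- e_ 6);
        entry 3 5 (e_ 1); entry 4 5 (e_ 1); entry 4 6 (e_ 1)].

End Examples.

(** * Formal deformations *)

Section Deformations.
Variables (m n : nat) (K : comNzRingType).

Local Notation V := 'rV[K]_(m + n).
(* V[[t]], which is V (x) K[[t]] since V is free of finite rank; a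
   K[[t]]-bilinear bracket (resp. K[[t]]-linear map) on it is the same as a
   series of bilinear (resp. linear) maps on V. *)
Local Notation Vt := 'rV[fps K]_(m + n).

Definition mod_t (x : Vt) : V := map_mx (fun f => fpscoef f 0%N) x.

Definition deformation (br : V -> V -> V) (brt : Vt -> Vt -> Vt) : Prop :=
  lie_superalgebra brt /\
  forall x y : V, mod_t (brt (map_mx (@fpsC K) x) (map_mx (@fpsC K) y)) = br x y.

Definition metric_deformation (br : V -> V -> V) (brt : Vt -> Vt -> Vt) : Prop :=
  deformation br brt /\ metric_lie_superalgebra brt.

(* Such an f is id + psi_1 t + psi_2 t^2 + ... with even psi_i. *)
Definition equivalent_def (brt brt' : Vt -> Vt -> Vt) : Prop :=
  exists2 f, lie_hom brt brt' f & forall x, mod_t (f x) = mod_t x.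

Definition trivial_def (br : V -> V -> V) (brt : Vt -> Vt -> Vt) : Prop :=
  equivalent_def brt (map_bracket (@fpsC K) br).

(* The substitution t |-> u(t) in all the maps phi_i t^i. *)
Definition reparam (u : fps K) (brt : Vt -> Vt -> Vt) : Vt -> Vt -> Vt :=
  map_bracket (fun f => fps_comp f u) brt.

(* "Unique up to equivalence and change of parameter" among the nontrivial
   metric deformations of br.  The change of parameter t |-> u(t) need not be
   invertible: t |-> t^2 is allowed. *)
Definition unique_up_to_equiv_and_param (br : V -> V -> V)
    (brt : Vt -> Vt -> Vt) : Prop :=
  forall brt', metric_deformation br brt' -> ~ trivial_def br brt' ->
  exists2 u : fps K, fpscoef u 0%N = 0 & equivalent_def brt' (reparam u brt).

End Deformations.

Section Convergent.
Variables (R : realType) (m n : nat).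

Local Notation C := R[i].
(* C^o is C with the topology given by its norm. *)
Local Notation V := 'rV[C]_(m + n).
Local Notation Vt := 'rV[fps C]_(m + n).

(* b is the bracket obtained from brt by giving t the complex value z: the
   power series of all the structure constants converge at z, with sums the
   structure constants of b. *)
Definition bracket_at (brt : Vt -> Vt -> Vt) (z : C) (b : V -> V -> V) : Prop :=
  bilinear_op b /\ forall i j k,
    series (fun l => fpscoef (brt (bvec _ i) (bvec _ j) 0 k) l * z ^+ l : C^o)
      @ \oo --> (b (bvec _ i) (bvec _ j) 0 k : C^o).

Definition punctured (r : R) (z : C) : Prop := 0 < `|z| < r%:C.

Definition jump_deformation (br : V -> V -> V) (brt : Vt -> Vt -> Vt)
    (h : V -> V -> V) : Prop :=
  ~ lie_isomorphic h br /\
  exists2 r : R, 0 < r & forall z, punctured r z ->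
    exists2 b, bracket_at brt z b & lie_isomorphic b h.

Definition family_symmetry (P : set C) (h : C -> V -> V -> V) (s : C -> C) : Prop :=
  forall l, P l -> P (s l) /\ lie_isomorphic (h (s l)) (h l).

(* S lists the symmetries of the family h.  Distinct values z, z' of the
   parameter may give isomorphic algebras only if they hit different members
   h (lam z), h (lam z') of the family that are exchanged by a symmetry. *)
Definition smooth_deformation_to (brt : Vt -> Vt -> Vt) (P : set C)
    (h : C -> V -> V -> V) (S : set (C -> C)) (l0 : C) : Prop :=
  (forall s, S s -> family_symmetry P h s) /\
  exists (r : R) (b : C -> V -> V -> V) (lam : C -> C),
  [/\ 0 < r,
      forall z, punctured r z ->
        [/\ bracket_at brt z (b z), P (lam z) & lie_isomorphic (b z) (h (lam z))],
      (lam z : C^o) @[z --> (0 : C^o)^'] --> (l0 : C^o)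
    & forall z z', punctured r z -> punctured r z' -> z != z' ->
        lie_isomorphic (b z) (b z') ->
        lam z' != lam z /\ exists2 s, S s & lam z' = s (lam z)].

End Convergent.

(* The nontrivial symmetries l |-> -l, 1/l, -1/l of the family g3_2_4. *)
Definition g3_symmetries (R : realType) : set (R[i] -> R[i]) :=
  [set s | [\/ s = (fun l => - l), s = (fun l => l^-1) | s = (fun l => - l^-1)]].

Definition smooth_around_itself (R : realType) (l0 : R[i]) brt : Prop :=
  smooth_deformation_to brt [set l | l != 0] (@g3_2_4 R[i]) (@g3_symmetries R) l0.

(* Main.v *)
(* Every algebra involved is the double extension of the symplectic space
   <e_3, e_4, e_5, e_6> by a matrix D, the action of e_2, with D Om symmetric.
   Letting D depend polynomially on t, the deformation (bracket_at), its
   reduction modulo t and its reparametrizations all come from ring morphisms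
   applied to D, and isomorphisms of double extensions amount to D P = b P D'.

   Let br be a metric deformation of g^3(l), l <> 0, 1, -1.  The scalar product
   forces the even part to be abelian.  The eigenvalues 1, l, -1, -l of ad e_2
   are distinct, so ad e_2 is diagonalizable over K[[t]], with eigenvectors F_i
   lifting the basis.  By Jacobi, (mu_i + mu_j) [F_i, F_j] = 0 and the brackets
   h = [F_3, F_5] and [F_4, F_6] are central, hence proportional; rescaling e_2
   and F_6 gives g^3(c) with c = mu_4 / mu_3, that is the family g^3(l + t)
   reparametrized by u = c - l.

   For l = 1 and l = -1 a nilpotent term t N commuting with D can be added to D,
   which gives the jump to g^4. *)

From HB Require Import structures.
Require Import Defs.
From mathcomp Require Import all_boot all_order all_algebra reals ring.
From mathcomp Require Import boolp classical_sets topology normedtype sequences.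

Set Implicit Arguments.
Unset Strict Implicit.
Unset Printing Implicit Defensive.

Import Order.TTheory GRing.Theory Num.Theory.
Import numFieldNormedType.Exports.
Local Open Scope ring_scope.
Local Open Scope complex_scope.

(** * Power series *)

Section Fps.
Variable K : comNzRingType.
Implicit Types f g u : fps K.

Definition ccoef0 f : K := fpscoef f 0.

Fact ccoef0_is_additive : {morph ccoef0 : f g / f - g}.
Proof. by []. Qed.
Fact ccoef0_is_monoid : monoid_morphism ccoef0.
Proof.
by split=> // f g; rewrite /ccoef0 /= big_ord_recl big_ord0 addr0 subn0.
Qed.
HB.instance Definition _ :=
  GRing.isZmodMorphism.Build (fps K) K ccoef0 ccoef0_is_additive.
HB.instance Definition _ :=
  GRing.isMonoidMorphism.Build (fps K) K ccoef0 ccoef0_is_monoid.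

Lemma fpsC_coef (a : K) n : fpscoef (fpsC a) n = if n == 0%N then a else 0.
Proof. by []. Qed.

Lemma ccoef0C (a : K) : ccoef0 (fpsC a) = a.
Proof. by []. Qed.

Lemma fpscoefM f g n :
  fpscoef (f * g) n = \sum_(i < n.+1) fpscoef f i * fpscoef g (n - i)%N.
Proof. by []. Qed.

Lemma fpscoef_CM (a : K) g n : fpscoef (fpsC a * g) n = a * fpscoef g n.
Proof.
rewrite fpscoefM big_ord_recl subn0 big1 ?addr0// => i _.
by rewrite fpsC_coef mul0r.
Qed.

Fact fpsC_is_additive : {morph @fpsC K : a b / a - b}.
Proof. by move=> a b; apply: fpsP => -[|n] //=; rewrite subr0. Qed.
Fact fpsC_is_monoid : monoid_morphism (@fpsC K).
Proof.
split=> // a b; apply: fpsP => n; rewrite fpscoef_CM !fpsC_coef.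
by case: ifP; rewrite ?mulr0.
Qed.
HB.instance Definition _ :=
  GRing.isZmodMorphism.Build K (fps K) (@fpsC K) fpsC_is_additive.
HB.instance Definition _ :=
  GRing.isMonoidMorphism.Build K (fps K) (@fpsC K) fpsC_is_monoid.

Definition fps_of_poly (p : {poly K}) : fps K := Fps (fun n => p`_n).

Fact fps_of_poly_is_additive : {morph fps_of_poly : p q / p - q}.
Proof. by move=> p q; apply: fpsP => n; rewrite /= coefB. Qed.
Fact fps_of_poly_is_monoid : monoid_morphism fps_of_poly.
Proof.
split=> [|p q]; apply: fpsP => n; first by rewrite /= coef1; case: n.
by rewrite fpscoefM /= coefM.
Qed.
HB.instance Definition _ :=
  GRing.isZmodMorphism.Build {poly K} (fps K) fps_of_poly
    fps_of_poly_is_additive.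
HB.instance Definition _ :=
  GRing.isMonoidMorphism.Build {poly K} (fps K) fps_of_poly
    fps_of_poly_is_monoid.

Lemma ccoef0_poly (p : {poly K}) : ccoef0 (fps_of_poly p) = p.[0].
Proof. by rewrite horner_coef0. Qed.

Lemma fpscoef_sum I (r : seq I) (P : pred I) (F : I -> fps K) n :
  fpscoef (\sum_(i <- r | P i) F i) n = \sum_(i <- r | P i) fpscoef (F i) n.
Proof.
by elim/big_rec2: _ => [|i x y _ <-] //=; rewrite if_same.
Qed.

(** A series without constant term is divisible by t, so its i-th power is divisible by t^i. *)
Lemma fpscoef_exp_lt u i n : ccoef0 u = 0 -> (n < i)%N -> fpscoef (u ^+ i) n = 0.
Proof.
move=> u0; elim: i n => // i IHi n; rewrite exprS fpscoefM ltnS => ni.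
rewrite big_ord_recl [fpscoef u _]u0 mul0r add0r big1// => -[j jn] _.
by rewrite IHi ?mulr0// lift0 /=; apply: leq_trans ni; rewrite ltn_subrL (leq_ltn_trans _ jn).
Qed.

Lemma fps_comp_poly (p : {poly K}) u : ccoef0 u = 0 ->
  fps_comp (fps_of_poly p) u = (map_poly (@fpsC K) p).[u].
Proof.
move=> u0; apply: fpsP => n /=.
rewrite horner_coef (size_map_inj_poly _ (rmorph0 _)); last first.
  by move=> a b /(congr1 ccoef0).
rewrite fpscoef_sum.
(* Both sums are compared with a longer common one. Its extra terms vanish on one side because u^i
   has order at least i, and on the other because the coefficients of [p] stop at [size p]. *)
transitivity (\sum_(i < n.+1 + size p) p`_i * fpscoef (u ^+ i) n).
  rewrite big_split_ord /= [X in _ + X]big1 ?addr0// => i _.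
  by rewrite fpscoef_exp_lt ?mulr0//= ltnS leq_addr.
rewrite addnC big_split_ord /= [X in _ + X]big1 ?addr0 => [|i _].
  by apply: eq_bigr => i _; rewrite coef_map -fpscoef_CM.
by rewrite nth_default ?mul0r// leq_addr.
Qed.

End Fps.

(* [eq_upto n] is congruence modulo t^n, so that a map improving it by one order
   is a contraction for the t-adic metric. *)
Section FixedPoint.
Variables (K : comNzRingType) (I : Type).
Implicit Types x y z : I -> fps K.

Definition eq_upto n x y := forall i k, (k < n)%N ->
  fpscoef (x i) k = fpscoef (y i) k.

Lemma contraction_fixed_point (phi : (I -> fps K) -> I -> fps K) :
  (forall n x y, eq_upto n x y -> eq_upto n.+1 (phi x) (phi y)) ->
  exists x, phi x =1 x.
Proof.
move=> phiP; pose it n := iter n phi (fun=> 0).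
have itP m n : eq_upto n (it n) (it (m + n)%N).
  elim: n => [|n IHn]; first by move=> i k; rewrite ltn0.
  by rewrite addnS; apply: phiP.
(* Diagonal limit: the iterate [it n] is final only in degrees below n, so the coefficient of degree
   k is read off the iterate k+1. *)
pose x i := Fps (fun k => fpscoef (it k.+1 i) k).
have xP n : eq_upto n x (it n).
  move=> i k kn; have := itP (n - k.+1)%N k.+1 i k (leqnn _).
  by rewrite subnK.
exists x => i; apply: fpsP => k.
by rewrite (phiP _ _ _ (xP k) i k).
Qed.

End FixedPoint.

Section EqUpto.
Variables (K : comNzRingType).
Implicit Types f g : fps K.

(** The factor [f] is divisible by t, so multiplication by it gains one order of agreement; this is
    the source of every contraction below. *)
Lemma fpscoefM_small n (f a b : fps K) : ccoef0 f = 0 ->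
  (forall k, (k < n)%N -> fpscoef a k = fpscoef b k) ->
  forall k, (k < n.+1)%N -> fpscoef (f * a) k = fpscoef (f * b) k.
Proof.
move=> f0 ab k kn; rewrite !fpscoefM !big_ord_recl [fpscoef f _]f0 !mul0r.
congr (_ + _); apply: eq_bigr => -[i ik] _; rewrite lift0 /=; congr (_ * _).
apply: ab; rewrite ltnS in kn; apply: leq_trans kn.
by rewrite ltn_subrL (leq_ltn_trans _ ik).
Qed.

Lemma fpscoefM_eq n (a b c d : fps K) :
  (forall k, (k < n)%N -> fpscoef a k = fpscoef b k) ->
  (forall k, (k < n)%N -> fpscoef c k = fpscoef d k) ->
  forall k, (k < n)%N -> fpscoef (a * c) k = fpscoef (b * d) k.
Proof.
move=> ab cd k kn; rewrite !fpscoefM; apply: eq_bigr => -[i ik] _ /=.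
by rewrite ab ?cd// ?(leq_ltn_trans (leq_subr _ _))// (leq_ltn_trans _ kn).
Qed.

End EqUpto.

(** * Inversion of power series over a field *)

Section FpsField.
Variable K : fieldType.
Implicit Types f g : fps K.

(** With b the inverse of the constant term, x = b - (b f - 1) x is a contraction because b f - 1
    has no constant term. Its fixed point satisfies b f x = b, hence f x = 1. *)
Lemma fps_inv_exists f : ccoef0 f != 0 -> exists g, g * f = 1.
Proof.
move=> f0; have [] := @contraction_fixed_point K unit
  (fun x _ => fpsC (ccoef0 f)^-1 - (fpsC (ccoef0 f)^-1 * f - 1) * x tt).
  move=> n x y xy _ k kn; congr (_ - _); apply: (fpscoefM_small _ (xy tt)) => //.
  by rewrite rmorphB rmorphM rmorph1 /= mulVf ?subrr.
move=> x /(_ tt) xE; exists (x tt).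
set a := fpsC (ccoef0 f); set b := fpsC (ccoef0 f)^-1 in xE.
have ab : a * b = 1 by rewrite -rmorphM mulfV ?rmorph1.
have bxf : b * (x tt * f) = b.
  have {xE}: x tt - (b - (b * f - 1) * x tt) = 0 by rewrite xE subrr.
  move=> xE; apply/eqP; rewrite -subr_eq0; apply/eqP; rewrite -{}xE; ring.
by rewrite -[LHS]mul1r -ab -mulrA bxf.
Qed.

Definition fps_unit : pred (fps K) := fun f => ccoef0 f != 0.

Definition fps_inv f : fps K :=
  if @idP (fps_unit f) is ReflectT f0 then projT1 (cid (fps_inv_exists f0))
  else f.

Fact fps_mulVr : {in fps_unit, left_inverse 1 fps_inv *%R}.
Proof.
move=> f; rewrite /fps_inv unfold_in => f0; case: {-}_ / idP => // f0'.
by case: cid.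
Qed.

Fact fps_unitP f g : g * f = 1 -> fps_unit f.
Proof.
move=> /(congr1 (@ccoef0 K)); rewrite rmorphM rmorph1 /= => gf.
apply/eqP => f0; move: gf; rewrite f0 mulr0 => /esym/eqP.
by rewrite oner_eq0.
Qed.

Fact fps_inv_out : {in [predC fps_unit], fps_inv =1 id}.
Proof.
by move=> f /negP nf; rewrite /fps_inv; case: {-}_ / idP => // f0; case: nf.
Qed.

HB.instance Definition _ := GRing.ComNzRing_hasMulInverse.Build (fps K)
  fps_mulVr fps_unitP fps_inv_out.

Lemma fps_unitE f : (f \is a GRing.unit) = (ccoef0 f != 0).
Proof. by []. Qed.

End FpsField.

(** * Double extensions of a purely odd space of dimension 4 *)

Section Coordinates.
Variable A : comNzRingType.
Implicit Types (x y : 'rV[A]_(2 + 4)) (v w : 'rV[A]_4) (M N : 'M[A]_4).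

Definition c1 x : A := x 0 (lshift 4 ord0).
Definition c2 x : A := x 0 (lshift 4 ord_max).
Definition od x : 'rV[A]_4 := rsubmx x.
Definition vec (a b : A) v : 'rV[A]_(2 + 4) :=
  row_mx (\row_i (if i == ord0 then a else b)) v.

Lemma c1_vec a b v : c1 (vec a b v) = a.
Proof. by rewrite /c1 row_mxEl mxE. Qed.
Lemma c2_vec a b v : c2 (vec a b v) = b.
Proof. by rewrite /c2 row_mxEl mxE. Qed.
Lemma od_vec a b v : od (vec a b v) = v.
Proof. exact: row_mxKr. Qed.
Definition vecE := (c1_vec, c2_vec, od_vec).

Lemma vec_eta x : x = vec (c1 x) (c2 x) (od x).
Proof.
rewrite -[LHS]hsubmxK; congr row_mx; apply/rowP => i; rewrite !mxE /c1 /c2.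
by case: i => -[|[|]] //= i2; congr (x _ _); apply: val_inj.
Qed.

Lemma vecP x y : c1 x = c1 y -> c2 x = c2 y -> od x = od y -> x = y.
Proof. by move=> e1 e2 e3; rewrite [x]vec_eta [y]vec_eta e1 e2 e3. Qed.

Lemma c1D x y : c1 (x + y) = c1 x + c1 y. Proof. exact: mxE. Qed.
Lemma c2D x y : c2 (x + y) = c2 x + c2 y. Proof. exact: mxE. Qed.
Lemma odD x y : od (x + y) = od x + od y. Proof. exact: linearD. Qed.
Lemma c1Z a x : c1 (a *: x) = a * c1 x. Proof. exact: mxE. Qed.
Lemma c2Z a x : c2 (a *: x) = a * c2 x. Proof. exact: mxE. Qed.
Lemma odZ a x : od (a *: x) = a *: od x. Proof. exact: linearZ. Qed.
Lemma c1N x : c1 (- x) = - c1 x. Proof. exact: mxE. Qed.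
Lemma c2N x : c2 (- x) = - c2 x. Proof. exact: mxE. Qed.
Lemma odN x : od (- x) = - od x. Proof. exact: linearN. Qed.
Definition coordE := (c1D, c2D, odD, c1Z, c2Z, odZ, c1N, c2N, odN, vecE).

Lemma homog_even x : homog false x <-> od x = 0.
Proof.
split=> [x0|x0 i].
  by apply/rowP => j; rewrite !mxE; apply: x0.
rewrite [x]vec_eta x0; case: (splitP i) => j ij; first by rewrite /parity ij leqNgt ltn_ord.
move=> _; rewrite (_ : i = rshift 2 j); last exact: val_inj.
by rewrite row_mxEr mxE.
Qed.

Lemma homog_odd x : homog true x <-> c1 x = 0 /\ c2 x = 0.
Proof.
split=> [x0|[x1 x2] i].
  by split; apply: x0.
rewrite [x]vec_eta x1 x2; case: (splitP i) => j ij; last by rewrite /parity ij leq_addr.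
move=> _; rewrite (_ : i = lshift 4 j); last exact: val_inj.
by rewrite row_mxEl mxE if_same.
Qed.

Lemma vec_sum_delta v : vec 0 0 v = \sum_j v 0 j *: vec 0 0 (delta_mx 0 j).
Proof.
pose g (u : 'rV[A]_4) := vec 0 0 u.
have gl : linear g.
  by move=> a u w; apply: vecP; rewrite !(vecE, c1D, c2D, odD, c1Z, c2Z, odZ) ?mulr0 ?addr0.
pose gL : {linear 'rV[A]_4 -> 'rV[A]_(2 + 4)} :=
  HB.pack g (GRing.isLinear.Build _ _ _ _ g gl).
rewrite {1}(row_sum_delta v) -[LHS]/(gL _) linear_sum.
by apply: eq_bigr => j _; rewrite linearZ.
Qed.

Lemma vec0 : vec 0 0 0 = 0.
Proof. by apply: vecP; rewrite ?vecE /c1 /c2 /od ?mxE ?linear0. Qed.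

Lemma vec_split x : x = c1 x *: vec 1 0 0 + c2 x *: vec 0 1 0 + vec 0 0 (od x).
Proof. by apply: vecP; rewrite !coordE; [ring | ring | rewrite !scaler0 !add0r]. Qed.

Definition bform M v w : A := (v *m M *m w^T) 0 0.

Lemma formDl M v v' w : bform M (v + v') w = bform M v w + bform M v' w.
Proof. by rewrite /bform !mulmxDl mxE. Qed.
Lemma formDr M v w w' : bform M v (w + w') = bform M v w + bform M v w'.
Proof. by rewrite /bform raddfD mulmxDr mxE. Qed.
Lemma formZl M a v w : bform M (a *: v) w = a * bform M v w.
Proof. by rewrite /bform -!scalemxAl mxE. Qed.
Lemma formZr M a v w : bform M v (a *: w) = a * bform M v w.
Proof. by rewrite /bform linearZ -scalemxAr mxE. Qed.
Lemma formNl M v w : bform M (- v) w = - bform M v w.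
Proof. by rewrite -scaleN1r formZl mulN1r. Qed.
Lemma formNr M v w : bform M v (- w) = - bform M v w.
Proof. by rewrite -scaleN1r formZr mulN1r. Qed.
Lemma form0l M w : bform M 0 w = 0.
Proof. by rewrite /bform !mul0mx mxE. Qed.
Lemma form0r M v : bform M v 0 = 0.
Proof. by rewrite /bform trmx0 mulmx0 mxE. Qed.
Lemma form_tr M v w : bform M w v = bform M^T v w.
Proof.
have -> : bform M^T v w = ((w *m M *m v^T)^T) 0 0.
  by rewrite !trmx_mul trmxK mulmxA.
by rewrite mxE.
Qed.
Lemma formMl M N v w : bform M (v *m N) w = bform (N *m M) v w.
Proof. by rewrite /bform !mulmxA. Qed.
Lemma formMr M N v w : bform M v (w *m N) = bform (M *m N^T) v w.
Proof. by rewrite /bform trmx_mul !mulmxA. Qed.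
Lemma formNm M v w : bform (- M) v w = - bform M v w.
Proof. by rewrite /bform mulmxN mulNmx mxE. Qed.
Lemma formZm a M v w : bform (a *: M) v w = a * bform M v w.
Proof. by rewrite /bform -scalemxAr -scalemxAl mxE. Qed.

End Coordinates.

Definition formE := (formDl, formDr, formZl, formZr, formNl, formNr, form0l, form0r).

(* The pairing of e_3 with e_5 and of e_4 with e_6. *)
Definition Om (A : comNzRingType) : 'M[A]_4 :=
  \matrix_(i, j) ((j == i + 2 :> nat)%N%:R - (i == j + 2 :> nat)%N%:R).

Ltac mx4_tac := apply/matrixP => -[[|[|[|[|]]]] //= ?] -[[|[|[|[|]]]] //= ?];
  rewrite !mxE ?big_ord_recl ?big_ord0 /= ?mxE /=.

Section DoubleExtension.
Variable A : comNzRingType.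
Local Notation V := 'rV[A]_(2 + 4).
Local Notation Om := (Om A).
Implicit Types (x y z : V) (v w : 'rV[A]_4) (D P : 'M[A]_4).

Lemma trOm : Om^T = - Om.
Proof. by apply/matrixP => i j; rewrite !mxE opprB. Qed.

Lemma mulOm : Om *m Om = - 1%:M.
Proof. by mx4_tac; ring. Qed.

(* [e_2, v] = v D and [v, w] = Om (v D, w) e_1 for v, w odd. *)
Definition dext D x y : V :=
  vec (bform (D *m Om) (od x) (od y)) 0
      (c2 x *: (od y *m D) - c2 y *: (od x *m D)).

(** The standard scalar product of a double extension: a hyperbolic plane on e_1, e_2 plus the
    symplectic form on the odd part. It is the same for all D. *)
Definition dform x y : A := c1 x * c2 y + c2 x * c1 y + bform Om (od x) (od y).

Lemma dext_bilinear D : bilinear_op (dext D).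
Proof.
split=> x a u v; apply: vecP; rewrite /dext !coordE ?formE ?mulr0 ?addr0 //;
  rewrite mulmxDl -scalemxAl; move: (od x *m D) (od u *m D) (od v *m D) => r s t;
  by apply/rowP => j; rewrite !mxE; ring.
Qed.

Lemma dext_homog D p q x y :
  homog p x -> homog q y -> homog (p (+) q) (dext D x y).
Proof.
case: p q => -[] /=.
- move=> /homog_odd[_ x2] /homog_odd[_ y2]; apply/homog_even.
  by rewrite /dext x2 y2 !coordE !scale0r subr0.
- move=> _ /homog_even y0; apply/homog_odd.
  by rewrite /dext y0 !coordE formE.
- move=> /homog_even x0 _; apply/homog_odd.
  by rewrite /dext x0 !coordE formE.
- move=> /homog_even x0 /homog_even y0; apply/homog_even.
  by rewrite /dext x0 y0 !coordE mul0mx !scaler0 subr0.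
Qed.

Section Symmetric.
Variable D : 'M[A]_4.
Hypothesis symD : (D *m Om)^T = D *m Om.

(** Symmetry of D Om means that D lies in the symplectic Lie algebra of [Om]. *)
Lemma symD_Om : Om *m D^T = - (D *m Om).
Proof. by rewrite -{}[in RHS]symD trmx_mul trOm mulNmx opprK. Qed.

Lemma form_sym v w : bform (D *m Om) w v = bform (D *m Om) v w.
Proof. by rewrite form_tr symD. Qed.

Lemma form_adj v w :
  bform (D *m Om) (v *m D) w = - bform (D *m Om) v (w *m D).
Proof. by rewrite formMl formMr -mulmxA symD_Om mulmxN formNm opprK. Qed.

(** In the Jacobi identity the e_1-component cancels because D is skew for the odd bracket form
    ([form_adj]). The odd component cancels because only powers of the single matrix D occur. *)
Lemma dext_lie : lie_superalgebra (dext D).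
Proof.
split; first exact: dext_bilinear.
- exact: dext_homog.
- move=> p q x y hx hy.
  have -> : (-1) ^+ (p && q) *: dext D x y = - dext D y x; last by rewrite opprK.
  apply: vecP; rewrite /dext !coordE ?mulr0 ?oppr0// ?(form_sym (od x)).
    case: p q hx hy => -[] /=; rewrite ?expr1 ?expr0 ?mulN1r ?mul1r //.
    - by move=> _ /homog_even->; rewrite formE oppr0.
    - by move=> /homog_even-> _; rewrite formE oppr0.
    - by move=> _ /homog_even->; rewrite formE oppr0.
  case: p q hx hy => -[] /=; rewrite ?expr1 ?expr0 ?scale1r ?opprB //.
  by move=> /homog_odd[_ ->] /homog_odd[_ ->]; rewrite !scale0r subrr scaler0.
- move=> p q x y z hx hy.
  have swap v w : bform (D *m Om) v (w *m D) = - bform (D *m Om) w (v *m D).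
    by rewrite -form_adj form_sym.
  apply: vecP; rewrite /dext !coordE ?mulr0 ?addr0 ?scale0r ?subr0 ?sub0r //.
    rewrite !formE ?formNr ?formZr; case: p q hx hy => -[] /=; rewrite ?expr1 ?expr0.
    + move=> /homog_odd[_ ->] /homog_odd[_ ->].
      by rewrite (swap (od x) (od y)); ring.
    + move=> _ /homog_even->; rewrite !(mul0mx, formE).
      by rewrite form_adj; ring.
    + move=> /homog_even-> _; rewrite !(mul0mx, formE).
      by rewrite form_adj; ring.
    + by move=> /homog_even-> /homog_even->; rewrite !(mul0mx, formE); ring.
  rewrite !mulmxBl -!scalemxAl.
  case: p q hx hy => -[] /=; rewrite ?expr1 ?expr0.
  + move=> /homog_odd[_ ->] /homog_odd[_ ->].
    by rewrite !(scale0r, scaler0, subr0, sub0r, oppr0, addr0).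
  + move=> _ /homog_even->; rewrite !mul0mx.
    move: (od x *m D *m D) (od z *m D *m D) => r s.
    by apply/rowP => j; rewrite !mxE; ring.
  + move=> /homog_even-> _; rewrite !mul0mx.
    move: (od y *m D *m D) (od z *m D *m D) => r s.
    by apply/rowP => j; rewrite !mxE; ring.
  + move=> /homog_even-> /homog_even->; rewrite !mul0mx.
    move: (od z *m D *m D) => r.
    by apply/rowP => j; rewrite !mxE; ring.
Qed.

Lemma dform_invariant : invariant_scalar_product (dext D) dform.
Proof.
have dformDr (x u v : V) a : dform x (a *: u + v) = a * dform x u + dform x v.
  by rewrite /dform !coordE !formE; ring.
have dformDl (x u v : V) a : dform (a *: u + v) x = a * dform u x + dform v x.
  by rewrite /dform !coordE !formE; ring.
have sup p q (x y : V) : homog p x -> homog q y -> dform y x = (-1) ^+ (p && q) * dform x y.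
  have oddf : bform Om (od y) (od x) = - bform Om (od x) (od y).
    by rewrite form_tr trOm formNm.
  rewrite /dform oddf; case: p q => -[] /=; rewrite ?expr1 ?expr0.
  - by move=> /homog_odd[-> ->] /homog_odd[-> ->]; ring.
  - by move=> _ /homog_even->; rewrite formE; ring.
  - by move=> /homog_even-> _; rewrite formE; ring.
  - by move=> _ /homog_even->; rewrite formE; ring.
split => //.
- by move=> x a u v; exact: dformDr.
- by move=> x a u v; exact: dformDl.
- move=> p q x y hx hy; case: p q hx hy => -[] hx hy // _.
    have [x1 x2] := (homog_odd x).1 hx; have y0 := (homog_even y).1 hy.
    by rewrite /dform x1 x2 y0 formE; ring.
  have [y1 y2] := (homog_odd y).1 hy; have x0 := (homog_even x).1 hx.
  by rewrite /dform y1 y2 x0 formE; ring.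
- move=> f; pose w : 'rV[A]_4 := \row_j f (vec 0 0 (delta_mx 0 j)).
  have fE y : f y = c1 y * f (vec 1 0 0) + c2 y * f (vec 0 1 0) + (w *m (od y)^T) 0 0.
    rewrite {1}(vec_split y) !linearD !linearZ vec_sum_delta linear_sum /=.
    congr (_ + _); rewrite mxE; apply: eq_bigr => j _.
    by rewrite linearZ !mxE /= mulrC.
  (* The vector representing [f]: the values at e_1 and e_2 are exchanged since [dform] pairs these
     two vectors, and the odd part uses that the inverse of [Om] is - [Om]. *)
  exists (vec (f (vec 0 1 0)) (f (vec 1 0 0)) (- (w *m Om))); split.
    have wO : - (w *m Om) *m Om = w.
      by rewrite mulNmx -mulmxA mulOm mulmxN mulmx1 opprK.
    by move=> y; rewrite (fE y) /dform !coordE /bform wO; ring.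
  move=> x' x'E; apply: vecP; rewrite ?coordE.
  - by rewrite -x'E /dform !coordE formE; ring.
  - by rewrite -x'E /dform !coordE formE; ring.
  - suff -> : w = od x' *m Om by rewrite -mulmxA mulOm mulmxN mulmx1 opprK.
    apply/rowP => j; rewrite mxE -x'E /dform !coordE !mulr0 !add0r.
    by rewrite /bform trmx_delta -colE mxE.
- move=> x y z; rewrite /dform /dext !coordE !formE.
  have adj v w : bform Om (v *m D) w = - bform Om v (w *m D).
    by rewrite formMl formMr symD_Om formNm opprK.
  by rewrite !formMl !formMr !symD_Om !formNm; ring.
Qed.

Lemma dext_metric : metric_lie_superalgebra (dext D).
Proof. by split; [exact: dext_lie | exists dform; exact: dform_invariant]. Qed.

End Symmetric.

(** The map scales e_1 by a and e_2 by c and acts on the odd part by P. The first condition is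
    compatibility with the action of e_2, the second with brackets of odd vectors. *)
Lemma dext_hom D D' (a c : A) P : D *m P = c *: (P *m D') ->
    P *m (D' *m Om) *m P^T = a *: (D *m Om) ->
  lie_hom (dext D) (dext D') (fun x => vec (a * c1 x) (c * c2 x) (od x *m P)).
Proof.
move=> DP aP; split.
- by move=> k u v; apply: vecP; rewrite !coordE; [ring|ring|rewrite mulmxDl scalemxAl].
- move=> [] x.
    by move=> /homog_odd[x1 x2]; apply/homog_odd; rewrite !coordE x1 x2 !mulr0.
  by move=> /homog_even x0; apply/homog_even; rewrite coordE x0 mul0mx.
- move=> x y; apply: vecP; rewrite /dext !coordE ?mulr0//.
    by rewrite formMl formMr aP formZm.
  rewrite mulmxBl -!scalemxAl -!mulmxA DP -!scalemxAr !scalerA.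
  by rewrite ![c * _]mulrC.
Qed.

Lemma dext_hom_bij (a c : A) P :
    (exists a', a' * a = 1) -> (exists c', c' * c = 1) -> (exists P', P *m P' = 1%:M) ->
  bijective (fun x => vec (a * c1 x) (c * c2 x) (od x *m P)).
Proof.
move=> [a' aK] [c' cK] [P' PK].
have P'K := mulmx1C PK.
exists (fun x => vec (a' * c1 x) (c' * c2 x) (od x *m P')) => x; apply: vecP;
  by rewrite !coordE ?mulrA -?mulmxA ?PK ?P'K ?aK ?cK ?(mulrC a) ?(mulrC c) ?aK ?cK
     ?mul1r ?mulmx1.
Qed.

Lemma dext_iso D D' (a c : A) P : D *m P = c *: (P *m D') ->
    P *m (D' *m Om) *m P^T = a *: (D *m Om) ->
    (exists a', a' * a = 1) -> (exists c', c' * c = 1) -> (exists P', P *m P' = 1%:M) ->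
  lie_isomorphic (dext D) (dext D').
Proof.
by move=> DP aP aK cK PK; eexists; [exact: dext_hom DP aP | exact: dext_hom_bij].
Qed.

Lemma dext_isometric D D' P : (D *m Om)^T = D *m Om -> (D' *m Om)^T = D' *m Om ->
    D *m P = P *m D' -> P *m Om *m P^T = Om ->
  isometrically_isomorphic (dext D) (dext D').
Proof.
move=> sD sD' DP PO.
exists dform, dform, (fun x => vec (1 * c1 x) (1 * c2 x) (od x *m P)); split.
- exact: dform_invariant.
- exact: dform_invariant.
- by apply: dext_hom; rewrite ?scale1r// -{2}PO -!mulmxA mulmxA -DP !mulmxA.
- apply: dext_hom_bij; try by exists 1; rewrite mulr1.
  (* A symplectic matrix is invertible, with inverse obtained from P Om P^T = Om and Om^2 = -1. *)
  exists (- (Om *m P^T *m Om)).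
  by rewrite mulmxN !mulmxA PO mulOm opprK.
- by move=> x y; rewrite /dform !coordE formMl formMr PO !mul1r.
Qed.

(** The scalar b is the e_2-coordinate of the image of e_2: its other even component is a multiple
    of the central vector e_1, which does not act on the odd part. *)
Lemma dext_hom_odd D D' f : lie_hom (dext D) (dext D') f ->
  exists b P, D *m P = b *: (P *m D') /\ forall v, f (vec 0 0 v) = vec 0 0 (v *m P).
Proof.
move=> [fl fe fb].
pose g v := od (f (vec 0 0 v)).
have gl : linear g.
  move=> a u v; rewrite /g -odZ -odD -fl; congr (od (f _)).
  by apply: vecP; rewrite !coordE ?mulr0 ?addr0.
pose gL : {linear 'rV[A]_4 -> 'rV[A]_4} := HB.pack g (GRing.isLinear.Build _ _ _ _ g gl).
pose P := lin1_mx gL.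
have fv v : f (vec 0 0 v) = vec 0 0 (v *m P).
  have /fe/homog_odd[f1 f2] : homog true (vec 0 0 v) by apply/homog_odd; rewrite !vecE.
  by rewrite mul_rV_lin1 /= /g; apply: vecP; rewrite ?f1 ?f2 !vecE.
exists (c2 (f (vec 0 1 0))), P; split=> //.
apply/row_matrixP => i; rewrite !rowE linearZ /= !mulmxA.
have := fb (vec 0 1 0) (vec 0 0 (delta_mx 0 i)); rewrite fv.
have -> : dext D (vec 0 1 0) (vec 0 0 (delta_mx 0 i)) = vec 0 0 (delta_mx 0 i *m D).
  by apply: vecP; rewrite /dext !vecE ?formE// scale1r scale0r subr0.
rewrite fv => /(congr1 (@od A)).
by rewrite /dext !vecE scale0r subr0.
Qed.

(** Since [f] preserves parity, its odd block P inherits injectivity and surjectivity; the even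
    component of a preimage contributes nothing to the odd part. *)
Lemma dext_iso_odd D D' : lie_isomorphic (dext D) (dext D') ->
  exists b P, [/\ D *m P = b *: (P *m D'), (forall v, v *m P = 0 -> v = 0)
    & forall v, exists w, v = w *m P].
Proof.
move=> [f hf fbij]; have [b [P [DP fv]]] := dext_hom_odd hf; have [fl fe _] := hf.
pose fL : {linear V -> V} := HB.pack f (GRing.isLinear.Build _ _ _ _ f fl).
exists b, P; split=> // v.
- move=> vP; have := fv v; rewrite vP vec0 -(linear0 fL) => /(bij_inj fbij).
  by move=> /(congr1 (@od A)); rewrite vecE /od linear0.
- have [f' _ f'K] := fbij; exists (od (f' (vec 0 0 v))).
  have := f'K (vec 0 0 v); rewrite {1}[f' _]vec_eta; set x := f' _.
  have -> : vec (c1 x) (c2 x) (od x) = vec (c1 x) (c2 x) 0 + vec 0 0 (od x).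
    by apply: vecP; rewrite !coordE ?addr0 ?add0r.
  rewrite -[f _]/(fL _) linearD /= fv => /(congr1 (@od A)).
  have /fe/homog_even : homog false (vec (c1 x) (c2 x) 0) by apply/homog_even; rewrite vecE.
  by rewrite !coordE => ->; rewrite add0r.
Qed.

End DoubleExtension.

(** * The bracket tables as double extensions *)

Section Tables.
Variable A : comNzRingType.
Implicit Types l t : A.

Definition mx4 (s : seq (seq A)) : 'M[A]_4 :=
  \matrix_(i, j) nth 0 (nth [::] s i) j.

Definition diag4 l :=
  mx4 [:: [:: 1; 0; 0; 0]; [:: 0; l; 0; 0]; [:: 0; 0; -1; 0]; [:: 0; 0; 0; - l]].
(* [jordan] deforms [diag4 1] and [jordanN] deforms [diag4 (-1)]; g_{2|4}^4 is
   given by [jordan 1]. *)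
Definition jordan t :=
  mx4 [:: [:: 1; 0; 0; 0]; [:: t; 1; 0; 0]; [:: 0; 0; -1; - t]; [:: 0; 0; 0; -1]].
Definition jordanN t :=
  mx4 [:: [:: 1; 0; 0; 0]; [:: 0; -1; 0; 0]; [:: 0; - t; -1; 0]; [:: - t; 0; 0; 1]].

Lemma diag4Om l : diag4 l *m Om A =
  mx4 [:: [:: 0; 0; 1; 0]; [:: 0; 0; 0; l]; [:: 1; 0; 0; 0]; [:: 0; l; 0; 0]].
Proof. by mx4_tac; ring. Qed.
Lemma jordanOm t : jordan t *m Om A =
  mx4 [:: [:: 0; 0; 1; 0]; [:: 0; 0; t; 1]; [:: 1; t; 0; 0]; [:: 0; 1; 0; 0]].
Proof. by mx4_tac; ring. Qed.
Lemma jordanNOm t : jordanN t *m Om A =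
  mx4 [:: [:: 0; 0; 1; 0]; [:: 0; 0; 0; -1]; [:: 1; 0; 0; - t]; [:: 0; -1; - t; 0]].
Proof. by mx4_tac; ring. Qed.

Lemma diag4_sym l : (diag4 l *m Om A)^T = diag4 l *m Om A.
Proof. by rewrite diag4Om; mx4_tac. Qed.
Lemma jordan_sym t : (jordan t *m Om A)^T = jordan t *m Om A.
Proof. by rewrite jordanOm; mx4_tac. Qed.
Lemma jordanN_sym t : (jordanN t *m Om A)^T = jordanN t *m Om A.
Proof. by rewrite jordanNOm; mx4_tac. Qed.

Lemma jordan0 : jordan 0 = diag4 1.
Proof. by mx4_tac; rewrite ?oppr0. Qed.
Lemma jordanN0 : jordanN 0 = diag4 (-1).
Proof. by mx4_tac; rewrite ?oppr0 ?opprK. Qed.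

Lemma formS (M : 'M[A]_4) v w :
  bform M v w = \sum_i \sum_j v 0 i * M i j * w 0 j.
Proof.
rewrite /bform mxE exchange_big; apply: eq_bigr => j _ /=.
by rewrite !mxE mulr_suml.
Qed.

Local Notation o4 k := (@Ordinal 4 k isT).
Lemma idx6E : [/\ idx6 1 = lshift 4 ord0, idx6 2 = lshift 4 ord_max &
  [/\ idx6 3 = rshift 2 (o4 0), idx6 4 = rshift 2 (o4 1), idx6 5 = rshift 2 (o4 2)
    & idx6 6 = rshift 2 (o4 3)]].
Proof. by split; [| |split]; apply: val_inj; rewrite /idx6 /= inordK. Qed.

Lemma bvec1 : bvec A (lshift 4 ord0) = vec 1 0 0.
Proof.
apply: vecP; rewrite vecE /c1 /c2 ?mxE //=.
by apply/rowP => j; rewrite !mxE.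
Qed.
Lemma bvec_odd j : bvec A (rshift 2 j) = vec 0 0 (delta_mx 0 j).
Proof.
apply: vecP; rewrite vecE /c1 /c2 ?mxE //=.
by apply/rowP => k; rewrite !mxE (inj_eq (@rshift_inj _ _)).
Qed.

Lemma idx6_coord (x : 'rV[A]_(2 + 4)) :
  [/\ x 0 (idx6 2) = c2 x, x 0 (idx6 3) = od x 0 (o4 0), x 0 (idx6 4) = od x 0 (o4 1),
   x 0 (idx6 5) = od x 0 (o4 2) & x 0 (idx6 6) = od x 0 (o4 3)].
Proof. by have [_ -> [-> -> -> ->]] := idx6E; rewrite !mxE. Qed.

Lemma parity6 : [/\ parity (idx6 2) = false, parity (idx6 3), parity (idx6 4), parity (idx6 5)
  & parity (idx6 6)].
Proof. by have [_ -> [-> -> -> ->]] := idx6E. Qed.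

Lemma e_6 : [/\ e_ A 1 = vec 1 0 0, e_ A 3 = vec 0 0 (delta_mx 0 (o4 0)),
   e_ A 4 = vec 0 0 (delta_mx 0 (o4 1)), e_ A 5 = vec 0 0 (delta_mx 0 (o4 2))
   & e_ A 6 = vec 0 0 (delta_mx 0 (o4 3))].
Proof. by have [e1 e2 [e3 e4 e5 e6]] := idx6E; rewrite /e_ e1 e3 e4 e5 e6 bvec1 !bvec_odd. Qed.

Lemma sum4 (V : nmodType) (F : 'I_4 -> V) :
  \sum_i F i = F (o4 0) + F (o4 1) + F (o4 2) + F (o4 3).
Proof.
rewrite !big_ord_recl big_ord0 addr0 !addrA.
by congr (F _ + F _ + F _ + F _); apply: val_inj.
Qed.

Let row_case (v w : 'rV[A]_4) : v 0 (o4 0) = w 0 (o4 0) -> v 0 (o4 1) = w 0 (o4 1) ->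
  v 0 (o4 2) = w 0 (o4 2) -> v 0 (o4 3) = w 0 (o4 3) -> v = w.
Proof.
move=> e0 e1 e2 e3; apply/rowP => -[[|[|[|[|]]]] //= j];
  by rewrite (bool_irrelevance j isT).
Qed.

Ltac table_tac x y eqOm :=
  rewrite /table_bracket !big_cons big_nil /=;
  have [-> -> -> -> ->] := idx6_coord x; have [-> -> -> -> ->] := idx6_coord y;
  have [-> -> -> -> ->] := parity6; have [-> -> -> -> ->] := e_6;
  rewrite /= expr0 expr1; apply: vecP; rewrite /dext !coordE ?eqOm;
  move: (c2 x) (c2 y) (od x) (od y) => a b v w;
  rewrite ?[c1 0]mxE ?[c2 0]mxE ?(linear0 (@rsubmx A 1 2 4)) ?formS ?sum4 ?mxE /=;
  [ring | ring | ].

Lemma g3E l : g3_2_4 l = dext (diag4 l).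
Proof.
apply/funext => x; apply/funext => y; rewrite /g3_2_4.
table_tac x y diag4Om.
by apply: row_case; rewrite !mxE ?sum4 ?mxE /=; ring.
Qed.

Lemma g4E : @g4_2_4 A = dext (jordan 1).
Proof.
apply/funext => x; apply/funext => y; rewrite /g4_2_4.
table_tac x y jordanOm.
by apply: row_case; rewrite !mxE ?sum4 ?mxE /=; ring.
Qed.

End Tables.

(** * Isomorphisms realizing the symmetries of the family *)

Section Isomorphisms.
Variable K : fieldType.
Local Notation V := 'rV[K]_(2 + 4).
Implicit Types l b : K.

Lemma lie_isomorphic_trans m n (b1 b2 b3 : 'rV[K]_(m + n) -> 'rV[K]_(m + n) -> 'rV[K]_(m + n)) :
  lie_isomorphic b1 b2 -> lie_isomorphic b2 b3 -> lie_isomorphic b1 b3.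
Proof.
move=> [f [fl fe fb] fbij] [g [gl ge gb] gbij]; exists (g \o f).
  split=> [a u v|p x hx|x y] /=; first by rewrite fl gl.
    exact/ge/fe.
  by rewrite fb gb.
exact: bij_comp.
Qed.

(* Changes of basis realizing the symmetries l |-> -l and l |-> 1/l: [swapN] is
   e_4 |-> e_6, e_6 |-> - e_4, and [swapV] swaps (e_3, e_5) with (e_4, e_6). *)
Definition swapN : 'M[K]_4 :=
  mx4 [:: [:: 1; 0; 0; 0]; [:: 0; 0; 0; 1]; [:: 0; 0; 1; 0]; [:: 0; -1; 0; 0]].
Definition swapV : 'M[K]_4 :=
  mx4 [:: [:: 0; 1; 0; 0]; [:: 1; 0; 0; 0]; [:: 0; 0; 0; 1]; [:: 0; 0; 1; 0]].

Lemma swapN_isom : swapN *m Om K *m swapN^T = Om K.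
Proof.
have -> : swapN *m Om K =
    mx4 [:: [:: 0; 0; 1; 0]; [:: 0; -1; 0; 0]; [:: -1; 0; 0; 0]; [:: 0; 0; 0; -1]].
  by mx4_tac; ring.
by mx4_tac; ring.
Qed.

Lemma diag4N l : diag4 (- l) *m swapN = swapN *m diag4 l.
Proof. by mx4_tac; ring. Qed.

Lemma diag4_isometricN l :
  isometrically_isomorphic (dext (diag4 (- l))) (dext (diag4 l)).
Proof.
exact: dext_isometric (diag4_sym _) (diag4_sym _) (diag4N l) swapN_isom.
Qed.

Lemma isometric_isomorphic m n (br br' : 'rV[K]_(m + n) -> 'rV[K]_(m + n) -> 'rV[K]_(m + n)) :
  isometrically_isomorphic br br' -> lie_isomorphic br br'.
Proof. by case=> [B [B' [f [_ _ hf bf _]]]]; exists f. Qed.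

(** Conjugation by [swapV] turns [diag4 l] into l times [diag4 l^-1]. The factor is absorbed by
    scaling e_2 by l^-1 and e_1 by l. *)
Lemma diag4_isoV l : l != 0 -> lie_isomorphic (dext (diag4 l^-1)) (dext (diag4 l)).
Proof.
move=> l0; have lV : l^-1 * l = 1 by rewrite mulVf.
apply: (@dext_iso _ _ _ l l^-1 swapV).
- by mx4_tac; rewrite ?(mulr0, mul0r, addr0, add0r, mulr1, mul1r, mulrN, mulN1r, mulrN1, lV) ?oppr0.
- rewrite !diag4Om.
  have -> : swapV *m mx4 [:: [:: 0; 0; 1; 0]; [:: 0; 0; 0; l]; [:: 1; 0; 0; 0]; [:: 0; l; 0; 0]]
     = mx4 [:: [:: 0; 0; 0; l]; [:: 0; 0; 1; 0]; [:: 0; l; 0; 0]; [:: 1; 0; 0; 0]].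
    by mx4_tac; ring.
  by mx4_tac; rewrite ?mulfV//; ring.
- by exists l^-1.
- by exists l; rewrite mulfV.
- by exists swapV; mx4_tac; ring.
Qed.

End Isomorphisms.

(** * Classification up to isomorphism *)

Section Classification.
Variable K : fieldType.
Implicit Types l b : K.

(** For diagonal matrices D P = b P D' lets P i j be nonzero only when the i-th eigenvalue of D is b
    times the j-th one of D'. As P has no zero row and no zero column, the two spectra agree up to
    the factor b. *)
Lemma diag4_isoP l l' : l != 0 -> l' != 0 ->
    lie_isomorphic (dext (diag4 l)) (dext (diag4 l')) ->
  [\/ l' = l, l' = - l, l' = l^-1 | l' = - l^-1].
Proof.
move=> l0 l'0 /dext_iso_odd[b [P [DP P0 Psurj]]].
pose d k : 'I_4 -> K := fun i => nth 0 [:: 1; k; -1; - k] i.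
have dE k (i j : 'I_4) : diag4 k i j = if i == j then d k i else 0.
  by move: i j => -[[|[|[|[|]]]] //= ?] -[[|[|[|[|]]]] //= ?]; rewrite mxE.
have DPij i j : P i j * (d l i - b * d l' j) = 0.
  have := congr1 (fun M : 'M_4 => M i j) DP; rewrite !mxE.
  rewrite (bigD1 i) //= dE eqxx big1 => [|k /negPf ki]; last by rewrite dE eq_sym ki mul0r.
  rewrite (bigD1 j) //= dE eqxx big1 => [|k /negPf ki]; last by rewrite dE ki mulr0.
  rewrite !addr0 => E; rewrite mulrBr [P i j * d l i]mulrC E; ring.
have row i : exists j, d l i = b * d l' j.
  apply/not_existsP => nj; have /P0 : (delta_mx 0 i : 'rV[K]_4) *m P = 0.
    rewrite -rowE; apply/rowP => j; rewrite !mxE; have /eqP := DPij i j.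
    by rewrite mulf_eq0 subr_eq0 => /orP[/eqP//|/eqP/nj].
  by move=> /rowP/(_ i)/eqP; rewrite !mxE !eqxx oner_eq0.
have col j : exists i, d l i = b * d l' j.
  apply/not_existsP => ni; have [w /rowP/(_ j)/eqP] := Psurj (delta_mx 0 j).
  rewrite !mxE !eqxx big1 ?oner_eq0// => i _; have /eqP := DPij i j.
  by rewrite mulf_eq0 subr_eq0 => /orP[/eqP->|/eqP/ni//]; rewrite mulr0.
(* Squaring removes the signs and leaves the comparison of {1, l^2} with b^2 {1, l'^2}. *)
have dsq k i : d k i ^+ 2 = 1 \/ d k i ^+ 2 = k ^+ 2.
  by rewrite /d; case: i => -[|[|[|[|]]]] //= _; rewrite ?sqrrN ?expr1n; [left|right|left|right].
have row2 i : d l i ^+ 2 = b ^+ 2 \/ d l i ^+ 2 = b ^+ 2 * l' ^+ 2.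
  have [j ->] := row i; rewrite exprMn.
  by have [->|->] := dsq l' j; [left; rewrite mulr1|right].
have col2 j : b ^+ 2 * d l' j ^+ 2 = 1 \/ b ^+ 2 * d l' j ^+ 2 = l ^+ 2.
  by have [i ij] := col j; rewrite -exprMn -ij.
have row0 : 1 = b ^+ 2 \/ 1 = b ^+ 2 * l' ^+ 2 by have := row2 ord0; rewrite /d /= expr1n.
have row1 : l ^+ 2 = b ^+ 2 \/ l ^+ 2 = b ^+ 2 * l' ^+ 2 by exact: (row2 (@Ordinal 4 1 isT)).
have col0 : b ^+ 2 = 1 \/ b ^+ 2 = l ^+ 2 by have := col2 ord0; rewrite /d /= expr1n mulr1.
have col1 : b ^+ 2 * l' ^+ 2 = 1 \/ b ^+ 2 * l' ^+ 2 = l ^+ 2 by exact: (col2 (@Ordinal 4 1 isT)).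
(* Either b^2 = 1 and the squares agree, or b^2 l'^2 = 1. In the latter case l^2 = b^2 gives (l'
   l)^2 = 1, and otherwise l^2 = 1 forces b^2 = l'^2 = 1. *)
have [/eqP|/eqP] : l' ^+ 2 = l ^+ 2 \/ (l' * l) ^+ 2 = 1.
  rewrite exprMn; move: row0 row1 col0 col1; rewrite -!/(_ ^+ 2).
  move: (b ^+ 2) (l ^+ 2) (l' ^+ 2) => B L L' [<-|E].
    by rewrite !mul1r => -[] E1 _ [] E2; left; congruence.
  rewrite -E => -[] E1.
    by rewrite E1 mulrC; right.
  by case=> EB; left; move: E; rewrite EB ?E1 mul1r.
- by rewrite eqf_sqr => /orP[]/eqP; [constructor 1|constructor 2].
- rewrite -(expr1n _ 2) eqf_sqr => /orP[]/eqP E.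
    by constructor 3; rewrite -[LHS](mulfK l0) E mul1r.
  by constructor 4; rewrite -[LHS](mulfK l0) E mulN1r.
Qed.

(** The square of [diag4 l] is the identity, so an isomorphism would make the square J^2 of
    [jordan 1] act as b^2 through the injective P. The first basis vector gives b^2 = 1, while J^2
    sends the second to itself plus twice the first, which is impossible when 2 is nonzero. *)
Lemma jordan_not_iso_diag4 l : (2%:R : K) != 0 -> l ^+ 2 = 1 ->
  ~ lie_isomorphic (dext (jordan 1)) (dext (diag4 l)).
Proof.
move=> char2 l1 /dext_iso_odd[b [P [DP P0 _]]].
have D2 : diag4 l *m diag4 l = 1%:M.
  by mx4_tac; rewrite ?(mulr0, mul0r, addr0, add0r, mulr1, mulrN, mulNr, opprK, oppr0) -?expr2 ?l1.
have J2 : jordan 1 *m jordan 1 *m P = b ^+ 2 *: P.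
  by rewrite -mulmxA DP -scalemxAr mulmxA DP -scalemxAl -mulmxA D2 mulmx1 scalerA.
have e0 : (delta_mx 0 ord0 : 'rV[K]_4) *m P = b ^+ 2 *: ((delta_mx 0 ord0 : 'rV_4) *m P).
  rewrite scalemxAr -J2 !mulmxA; congr (_ *m P); rewrite -!rowE -row_mul.
  by apply/rowP => -[[|[|[|[|]]]] //= ?]; rewrite !mxE ?big_ord_recl ?big_ord0 /= ?mxE /=; ring.
pose o1 : 'I_4 := @Ordinal 4 1 isT.
have e1 : (delta_mx 0 o1 : 'rV[K]_4) *m P + 2%:R *: ((delta_mx 0 ord0 : 'rV_4) *m P)
    = b ^+ 2 *: ((delta_mx 0 o1 : 'rV_4) *m P).
  rewrite [in RHS]scalemxAr -J2 !mulmxA scalemxAl -mulmxDl; congr (_ *m P); rewrite -!rowE -row_mul.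
  by apply/rowP => -[[|[|[|[|]]]] //= ?]; rewrite !mxE ?big_ord_recl ?big_ord0 /= ?mxE /=; ring.
have nz (i : 'I_4) : (delta_mx 0 i : 'rV[K]_4) *m P != 0.
  apply/eqP => /P0/rowP/(_ i)/eqP; rewrite !mxE !eqxx oner_eq0.
  by [].
have b1 : b ^+ 2 = 1.
  have : (1 - b ^+ 2) *: ((delta_mx 0 ord0 : 'rV[K]_4) *m P) = 0.
    by rewrite scalerBl scale1r -e0 subrr.
  by move=> /eqP; rewrite scaler_eq0 (negPf (nz _)) orbF subr_eq0 => /eqP.
move: e1; rewrite b1 scale1r => /eqP; rewrite -subr_eq0 addrC addKr scaler_eq0.
by rewrite (negPf char2) (negPf (nz _)).
Qed.

(** The off-diagonal entry is normalized by scaling e_3 by z^-1 and, to preserve [Om], e_5 by z. *)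
Lemma jordan_iso z : z != 0 -> lie_isomorphic (dext (jordan z)) (dext (jordan (1 : K))).
Proof.
move=> z0; pose P k : 'M[K]_4 :=
  mx4 [:: [:: k^-1; 0; 0; 0]; [:: 0; 1; 0; 0]; [:: 0; 0; k; 0]; [:: 0; 0; 0; 1]].
have zV : z * z^-1 = 1 by rewrite mulfV.
have Vz : z^-1 * z = 1 by rewrite mulVf.
pose sE := (mulr0, mul0r, addr0, add0r, mulr1, mul1r, mulrN, mulNr, opprK, oppr0, zV, Vz, expr2).
apply: (@dext_iso _ _ _ 1 1 (P z)).
- by mx4_tac; rewrite ?sE.
- rewrite !jordanOm scale1r.
  have -> : P z *m mx4 [:: [:: 0; 0; 1; 0]; [:: 0; 0; 1; 1]; [:: 1; 1; 0; 0]; [:: 0; 1; 0; 0]]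
     = mx4 [:: [:: 0; 0; z^-1; 0]; [:: 0; 0; 1; 1]; [:: z; z; 0; 0]; [:: 0; 1; 0; 0]].
    by mx4_tac; rewrite ?sE.
  by mx4_tac; rewrite ?sE.
- by exists 1; rewrite mulr1.
- by exists 1; rewrite mulr1.
- by exists (P z^-1); mx4_tac; rewrite ?invrK ?sE.
Qed.

(** The symplectic matrix [swapN] that exchanges l and -l also carries [jordanN] to [jordan]. *)
Lemma jordanN_iso z : lie_isomorphic (dext (jordanN z)) (dext (jordan (z : K))).
Proof.
apply: isometric_isomorphic; apply: dext_isometric (jordanN_sym _) (jordan_sym _) _ (swapN_isom K).
by mx4_tac; ring.
Qed.

End Classification.

(** * Polynomial families *)

Section MapDext.
Variables (A A' : comNzRingType) (phi : {rmorphism A -> A'}).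

Lemma map_vec a b v : map_mx phi (vec a b v) = vec (phi a) (phi b) (map_mx phi v).
Proof.
rewrite /vec map_row_mx; congr row_mx; apply/rowP => i; rewrite !mxE.
by case: ifP.
Qed.

Lemma map_Om : map_mx phi (Om A) = Om A'.
Proof. by apply/matrixP => i j; rewrite !mxE rmorphB !rmorph_nat. Qed.

(** The bracket is polynomial in D and in the coordinates, so it commutes with ring morphisms. This
    is applied to evaluation of t, to the inclusion of polynomials in series and to substitution. *)
Lemma map_dext D x y :
  map_mx phi (dext D x y) = dext (map_mx phi D) (map_mx phi x) (map_mx phi y).
Proof.
rewrite /dext map_vec rmorph0; congr vec.
- rewrite /bform -map_Om /od -!map_rsubmx map_trmx -!map_mxM /=.
  by rewrite [in RHS]mxE.
- by rewrite map_mxB !map_mxZ !map_mxM /c2 !mxE /od !map_rsubmx.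
Qed.

Lemma map_dext_sym D : (D *m Om A)^T = D *m Om A ->
  (map_mx phi D *m Om A')^T = map_mx phi D *m Om A'.
Proof. by move=> sD; rewrite -map_Om -map_mxM map_trmx sD. Qed.

Lemma map_mx4 s : map_mx phi (mx4 s) = mx4 (map (map phi) s).
Proof.
apply/matrixP => i j; rewrite !mxE.
have [si|si] := ltnP i (size s); last first.
  by rewrite !(@nth_default _ [::]) ?size_map// !nth_nil rmorph0.
rewrite (nth_map [::])//; have [sj|sj] := ltnP j (size (nth [::] s i)).
  by rewrite (nth_map 0).
by rewrite !(@nth_default _ 0) ?size_map ?rmorph0.
Qed.

Lemma map_diag4 l : map_mx phi (diag4 l) = diag4 (phi l).
Proof. by rewrite map_mx4 /= !(rmorphN, rmorph1, rmorph0). Qed.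
Lemma map_jordan l : map_mx phi (jordan l) = jordan (phi l).
Proof. by rewrite map_mx4 /= !(rmorphN, rmorph1, rmorph0). Qed.
Lemma map_jordanN l : map_mx phi (jordanN l) = jordanN (phi l).
Proof. by rewrite map_mx4 /= !(rmorphN, rmorph1, rmorph0). Qed.

Lemma map_bvec i : map_mx phi (bvec A i) = bvec A' i :> 'rV_(2 + 4).
Proof. by rewrite /bvec map_delta_mx. Qed.

End MapDext.

Lemma bilinear_op_expand (m n : nat) (A : comNzRingType)
    (f : 'rV[A]_(m + n) -> 'rV[A]_(m + n) -> 'rV[A]_(m + n)) : bilinear_op f ->
  forall x y, f x y = \sum_i \sum_j (x 0 i * y 0 j) *: f (bvec A i) (bvec A j).
Proof.
move=> [fr fl] x y.
pose fR z : {linear 'rV[A]_(m + n) -> 'rV[A]_(m + n)} :=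
  HB.pack (f z) (GRing.isLinear.Build _ _ _ _ (f z) (fr z)).
pose fL z : {linear 'rV[A]_(m + n) -> 'rV[A]_(m + n)} :=
  HB.pack (f^~ z) (GRing.isLinear.Build _ _ _ _ (f^~ z) (fl z)).
rewrite {1}(row_sum_delta x) -[LHS]/(fL y _) linear_sum; apply: eq_bigr => i _.
rewrite linearZ /= {1}(row_sum_delta y) -[f _ _]/(fR _ _) linear_sum scaler_sumr.
by apply: eq_bigr => j _; rewrite linearZ scalerA.
Qed.

Lemma map_bracket_dext (A A' : comNzRingType) (phi : {rmorphism A -> A'}) D :
  map_bracket phi (dext D) = dext (map_mx phi D).
Proof.
apply/funext => x; apply/funext => y; rewrite (bilinear_op_expand (dext_bilinear _)).
apply: eq_bigr => i _; apply: eq_bigr => j _; congr (_ *: _).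
by rewrite map_dext !map_bvec.
Qed.

Section PolyFamily.
Variable K : comNzRingType.
Variable D : 'M[{poly K}]_4.
Hypothesis symD : (D *m Om _)^T = D *m Om _.

(** Taking D polynomial in t makes the series of [bracket_at] finite sums and turns a change of
    parameter into an evaluation of polynomials. *)
Definition pdext := dext (map_mx (@fps_of_poly K) D).

Lemma pdext_metric : metric_deformation (dext (map_mx (horner_eval 0) D)) pdext.
Proof.
have lie := dext_metric (map_dext_sym (@fps_of_poly K) symD).
split=> //; split=> [|x y]; first by case: lie.
rewrite -[LHS]/(map_mx (@ccoef0 K) _) /pdext map_dext; congr (dext _ _ _).
- by apply/matrixP => i j; rewrite !mxE; exact: ccoef0_poly.
- by apply/matrixP => i j; rewrite !mxE.
- by apply/matrixP => i j; rewrite !mxE.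
Qed.

Lemma pdext_coef i j k :
  pdext (bvec _ i) (bvec _ j) 0 k = fps_of_poly (dext D (bvec _ i) (bvec _ j) 0 k).
Proof. by rewrite /pdext -!(map_bvec (@fps_of_poly K)) -map_dext mxE. Qed.

(** On polynomials, substitution of u is the ring morphism [phi], so it passes through [dext] to the
    matrix D. *)
Lemma pdext_reparam u : ccoef0 u = 0 ->
  reparam u pdext = dext (map_mx (fun p => (map_poly (@fpsC K) p).[u]) D).
Proof.
move=> u0; pose phi : {rmorphism {poly K} -> fps K} :=
  horner_eval u \o map_poly (@fpsC K).
apply/funext => x; apply/funext => y.
rewrite -[map_mx _ D]/(map_mx phi D) (bilinear_op_expand (dext_bilinear _)).
apply: eq_bigr => i _; apply: eq_bigr => j _; congr (_ *: _).
have -> : dext (map_mx phi D) (bvec _ i) (bvec _ j) =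
    map_mx phi (dext D (bvec _ i) (bvec _ j)) by rewrite map_dext !map_bvec.
by apply/rowP => k; rewrite [LHS]mxE [RHS]mxE pdext_coef; apply: fps_comp_poly.
Qed.

End PolyFamily.

(** * Values at complex parameters: smooth and jump deformations *)

Section PolyFamilyAt.
Variable R : realType.
Local Notation C := R[i].

Lemma poly_series_cvg (p : {poly C}) (z : C) :
  (series (fun l => p`_l * z ^+ l : C^o) @ \oo --> (p.[z] : C^o))%classic.
Proof.
apply: cvg_near_cst; exists (size p) => // n /= pn.
rewrite /series /= horner_coef -(big_mkord xpredT (fun i => p`_i * z ^+ i)).
rewrite (big_cat_nat (leq0n _) pn) /= [X in _ + X]big1_seq ?addr0// => i /andP[_].
by rewrite mem_index_iota => /andP[pi _]; rewrite nth_default ?mul0r.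
Qed.

Lemma pdext_at (D : 'M[{poly C}]_4) (z : C) :
  bracket_at (pdext D) z (dext (map_mx (horner_eval z) D)).
Proof.
split=> [|i j k]; first exact: dext_bilinear.
have -> : dext (map_mx (horner_eval z) D) (bvec _ i) (bvec _ j) 0 k =
    (dext D (bvec _ i) (bvec _ j) 0 k).[z].
  by rewrite -!(map_bvec (horner_eval z)) -map_dext [LHS]mxE.
rewrite pdext_coef.
exact: poly_series_cvg.
Qed.

Lemma small_radius (l : C) : l != 0 ->
  exists2 r : R, 0 < r & forall z, punctured r z -> l + z != 0.
Proof.
(* The radius is the distance from l to 0; the real part is taken because the norm has values in the
   complex numbers. *)
move=> l0; exists (complex.Re `|l|).
  by rewrite -ltcR RRe_real ?normr_real// normr_gt0.
move=> z /andP[_]; rewrite RRe_real ?normr_real// => zl.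
by apply: contraTneq zl => /eqP; rewrite addr_eq0 => /eqP->; rewrite normrN ltxx.
Qed.

(** The parameter l + z is injective in z and, near 0, avoids the value 0. By [diag4_isoP] two
    isomorphic members are then exchanged by one of the three listed symmetries. *)
Lemma diag4_smooth (l : C) : l != 0 ->
  smooth_around_itself l (pdext (diag4 (l%:P + 'X))).
Proof.
move=> l0; rewrite /smooth_around_itself; split.
  have iN (k : C) : lie_isomorphic (g3_2_4 (- k)) (g3_2_4 k).
    by rewrite !g3E; exact/isometric_isomorphic/diag4_isometricN.
  have iV (k : C) : k != 0 -> lie_isomorphic (g3_2_4 k^-1) (g3_2_4 k).
    by rewrite !g3E; exact: diag4_isoV.
  move=> s [] -> k /= k0; rewrite ?oppr_eq0 ?invr_eq0; split=> //.
  - exact: iV.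
  - exact: lie_isomorphic_trans (iN _) (iV _ k0).
have [r r0 rP] := small_radius l0.
exists r, (fun z => g3_2_4 (l + z)), (fun z => l + z); split => //.
- move=> z zr; split; last by exists id; [split|exists id].
    rewrite g3E; have := pdext_at (diag4 (l%:P + 'X)) z.
    by rewrite map_diag4 /= /horner_eval !hornerE.
  exact: rP.
- have h : ((l + z : C^o) @[z --> (0 : C^o)] --> (l + 0 : C^o))%classic.
    exact: (@cvgD C C^o _ (nbhs (0 : C^o)) _ (fun=> l) id l 0 (cvg_cst _) cvg_id).
  by rewrite addr0 in h; move=> A /h; exact: nbhs_dnbhs.
- move=> z z' zr z'r zz'; rewrite !g3E => /(diag4_isoP (rP _ zr) (rP _ z'r)) iso.
  have ne : l + z' != l + z by rewrite (inj_eq (addrI l)) eq_sym.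
  split=> //; case: iso => E; first by rewrite E eqxx in ne.
  - by exists -%R => //; constructor 1.
  - by exists GRing.inv => //; constructor 2.
  - by exists (fun l => - l^-1) => //; constructor 3.
Qed.

Lemma two_neq0 : (2%:R : C) != 0.
Proof. by rewrite pnatr_eq0. Qed.

Lemma jordan_jump (l : C) (D : 'M[{poly C}]_4) : l ^+ 2 = 1 ->
  (forall z : C, z != 0 -> lie_isomorphic (dext (map_mx (horner_eval z) D)) (dext (jordan 1))) ->
  jump_deformation (g3_2_4 l) (pdext D) (@g4_2_4 C).
Proof.
move=> l1 DJ; rewrite g3E g4E; split; first exact: jordan_not_iso_diag4 two_neq0 l1.
exists 1 => // z /andP[]; rewrite normr_gt0 => z0 _; exists (dext (map_mx (horner_eval z) D)).
  exact: pdext_at.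
exact: DJ.
Qed.

End PolyFamilyAt.

(** * Uniqueness *)

Section Eigenvectors.
Variables (K : fieldType) (n : nat) (M : 'M[fps K]_n) (d : 'I_n -> K).
Hypothesis dinj : injective d.
Hypothesis M0 : map_mx (@ccoef0 K) M = diag_mx (\row_j d j).

(** Normalize x_i = 1 and eliminate the eigenvalue, which is then the i-th entry of x M. What
    remains is (d_i - d_j) x_j = sum_k (N_kj x_k - N_ki x_k x_j), where N is the part of M divisible
    by t. Dividing by d_i - d_j gives a contraction. *)
Lemma eigenvector_lift i : exists (v : 'rV[fps K]_n) mu,
  [/\ v *m M = mu *: v, map_mx (@ccoef0 K) v = delta_mx 0 i & ccoef0 mu = d i].
Proof.
pose N : 'M[fps K]_n := M - diag_mx (\row_j fpsC (d j)).
have N0 k j : ccoef0 (N k j) = 0.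
  have /matrixP/(_ k j) := M0; rewrite !mxE => E.
  by rewrite rmorphB /= E rmorphMn /= ?ccoef0C subrr.
have [] := @contraction_fixed_point K 'I_n (fun x j => if j == i then 1 else
    fpsC (d i - d j)^-1 * \sum_k (N k j * x k - N k i * (x k * x j))).
  move=> m x y xy j k km; case: eqP => // _; rewrite !fpscoef_CM !fpscoef_sum.
  congr (_ * _); apply: eq_bigr => p _; congr (_ - _).
    exact: (fpscoefM_small (N0 _ _) (xy p)).
  by apply: (fpscoefM_small (N0 _ _)) km; exact: fpscoefM_eq (xy p) (xy j).
move=> x xE.
have xi : x i = 1 by rewrite -xE eqxx.
have xj j : fpsC (d i - d j) * x j = \sum_k (N k j * x k - N k i * (x k * x j)).
  have [->|ji] := eqVneq j i.
    rewrite subrr rmorph0 mul0r big1// => k _; by rewrite xi mulr1 subrr.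
  rewrite -{1}xE (negPf ji) mulrA -rmorphM mulfV ?rmorph1 ?mul1r//.
  by rewrite subr_eq0 (inj_eq dinj) eq_sym.
have MN k j : M k j = N k j + fpsC (d j) *+ (k == j).
  by rewrite !mxE; case: eqP => [->|_]; rewrite ?mulr1n ?mulr0n ?subr0 ?addr0 ?subrK.
have sumM j : \sum_k x k * M k j = fpsC (d j) * x j + \sum_k N k j * x k.
  under eq_bigr do rewrite MN mulrDr mulrnAr.
  rewrite big_split addrC /=; congr (_ + _); first by apply: eq_bigr => k _; rewrite mulrC.
  by rewrite (bigD1 j)//= eqxx mulr1n mulrC big1 ?addr0// => k /negPf->.
exists (\row_j x j), (\sum_k x k * M k i); split.
- apply/rowP => j; rewrite !mxE; under eq_bigr do rewrite mxE.
  rewrite !sumM xi; have := xj j; rewrite rmorphB mulrBl sumrB => E.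
  have -> : (\sum_k N k j * x k) = fpsC (d i) * x j - fpsC (d j) * x j +
      \sum_k N k i * (x k * x j) by rewrite E subrK.
  rewrite mulrDl mulr_suml; under [X in _ = _ + X]eq_bigr do rewrite -mulrA.
  ring.
- apply/rowP => j; rewrite !mxE eqxx eq_sym /=; have [<-|ji] := eqVneq i j.
    by rewrite xi rmorph1.
  rewrite -xE eq_sym (negPf ji) rmorphM rmorph_sum big1 ?mulr0// => k _.
  by rewrite rmorphB !rmorphM /= !N0 !mul0r subr0.
- rewrite sumM xi mulr1 rmorphD /= ?ccoef0C rmorph_sum big1 ?addr0// => k _.
  by rewrite rmorphM /= N0 mul0r.
Qed.

End Eigenvectors.

Section BilinearOp.
Variables (m n : nat) (A : comNzRingType).
Local Notation V := 'rV[A]_(m + n).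
Variables (br : V -> V -> V) (brB : bilinear_op br).
Implicit Types (x y z : V) (a : A).

Lemma brDr x y z : br x (y + z) = br x y + br x z.
Proof. by have := brB.1 x 1 y z; rewrite !scale1r. Qed.
Lemma brDl x y z : br (x + y) z = br x z + br y z.
Proof. by have := brB.2 z 1 x y; rewrite !scale1r. Qed.
Lemma br0r x : br x 0 = 0.
Proof. by apply: (addrI (br x 0)); rewrite -brDr !addr0. Qed.
Lemma br0l x : br 0 x = 0.
Proof. by apply: (addrI (br 0 x)); rewrite -brDl !addr0. Qed.
Lemma brZr a x y : br x (a *: y) = a *: br x y.
Proof. by have := brB.1 x a y 0; rewrite !addr0 br0r addr0. Qed.
Lemma brZl a x y : br (a *: x) y = a *: br x y.
Proof. by have := brB.2 y a x 0; rewrite !addr0 br0l addr0. Qed.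
Lemma br_sumr I (r : seq I) x (F : I -> V) :
  br x (\sum_(i <- r) F i) = \sum_(i <- r) br x (F i).
Proof. exact: (big_morph (br x) (brDr x) (br0r x)). Qed.
Lemma br_suml I (r : seq I) y (F : I -> V) :
  br (\sum_(i <- r) F i) y = \sum_(i <- r) br (F i) y.
Proof. exact: (big_morph (br^~ y) (fun x z => brDl x z y) (br0l y)). Qed.

Lemma br_span2_eq0 x y a b c d : br x x = 0 -> br y y = 0 -> br x y = 0 -> br y x = 0 ->
  br (a *: x + b *: y) (c *: x + d *: y) = 0.
Proof.
by move=> xx yy xy yx; rewrite !(brDl, brDr, brZl, brZr) xx yy xy yx !(scaler0, addr0).
Qed.

Hypothesis brL : lie_superalgebra br.

Lemma br_skew_odd x y : homog true x -> homog true y -> br y x = br x y.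
Proof. by move=> hx hy; rewrite (ls_skew brL hx hy) /= expr1 scaleN1r opprK. Qed.
Lemma br_skew_even p x y : homog false x -> homog p y -> br y x = - br x y.
Proof. by move=> hx hy; rewrite (ls_skew brL hx hy) /= expr0 scale1r. Qed.
Lemma br_jacobi_odd x y z : homog true x -> homog true y ->
  br x (br y z) = br (br x y) z - br y (br x z).
Proof. by move=> hx hy; rewrite (ls_jacobi brL z hx hy) /= expr1 scaleN1r. Qed.
Lemma br_jacobi_even p x y z : homog false x -> homog p y ->
  br x (br y z) = br (br x y) z + br y (br x z).
Proof. by move=> hx hy; rewrite (ls_jacobi brL z hx hy) /= expr0 scale1r. Qed.

End BilinearOp.

(** * First consequences of being a metric deformation *)

Section MetricDeformation.
Variables (K : fieldType) (br : 'rV[fps K]_(2 + 4) -> 'rV[fps K]_(2 + 4) -> 'rV[fps K]_(2 + 4)).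
Hypothesis two0 : 2%:R != 0 :> K.
Local Notation A := (fps K).
Local Notation V := 'rV[A]_(2 + 4).
Implicit Types (x y z : V).

Lemma fps_addvv_eq0 x : x + x = 0 -> x = 0.
Proof.
have u2 : (2%:R : A) \is a GRing.unit by rewrite fps_unitE rmorph_nat.
move=> xx; have : 2%:R^-1 *: (2%:R *: x) = 0.
  by rewrite scaler_nat [x *+ 2]mulr2n xx scaler0.
by rewrite scalerA mulVr// scale1r.
Qed.

Hypothesis brL : lie_superalgebra br.
Let brB : bilinear_op br := ls_bilinear brL.

(* This is where the invariant scalar product is used. *)
Lemma even_part_abelian x y : (exists B, invariant_scalar_product br B) ->
  homog false x -> homog false y -> br x y = 0.
Proof.
move=> [B BI] hx hy.
have brxx z : homog false z -> br z z = 0.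
  by move=> hz; apply: fps_addvv_eq0; rewrite {1}(br_skew_even brL hz hz) addNr.
pose E1 : V := vec 1 0 0; pose E2 : V := vec 0 1 0.
have h1 : homog false E1 by apply/homog_even; rewrite vecE.
have h2 : homog false E2 by apply/homog_even; rewrite vecE.
pose e := br E1 E2.
have he : homog false e by exact: (ls_even brL h1 h2).
have Bsym z w : homog false z -> homog false w -> B w z = B z w.
  by move=> hz hw; rewrite (isp_supersym BI hz hw) /= expr0 mul1r.
have BZ z a w : B z (a *: w) = a * B z w.
  have B0 : B z 0 = 0.
    have := isp_linearr BI z 1 0 0; rewrite scale1r addr0 /= mul1r => E.
    by apply: (addrI (B z 0)); rewrite addr0 -E.
  by have := isp_linearr BI z a w 0; rewrite !addr0 B0 addr0.
have BD z w w' : B z (w + w') = B z w + B z w'.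
  by have := isp_linearr BI z 1 w w'; rewrite scale1r /= mul1r.
(* Invariance gives B([E1,E2],E1) = B(E1,[E2,E1]), which is -B(e,E1) by symmetry on the even part;
   then 2 is cancelled. *)
have Be1 : B e E1 = 0.
  have E : B e E1 = - B e E1.
    rewrite {1}(isp_invariant BI) (br_skew_even brL h1 h2) -scaleN1r BZ mulN1r.
    by rewrite -/e Bsym.
  have u2 : (2%:R : A) \is a GRing.unit by rewrite fps_unitE rmorph_nat.
  apply: (mulrI u2); rewrite mulr0 mulr_natl mulr2n {1}E addNr //.
have Be2 : B e E2 = 0.
  by rewrite (isp_invariant BI) brxx// -(scale0r E1) BZ mul0r.
have Be z : B e z = 0.
  have hz : homog true (vec 0 0 (od z)) by apply/homog_odd; rewrite !vecE.
  rewrite (vec_split z) BD (BD e) (BZ e) (BZ e) Be1 Be2 !mulr0 !add0r.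
  exact: (isp_even BI he hz).
(* So [e] is orthogonal to everything: [e] and 0 represent the same functional and non-degeneracy
   identifies them. *)
have e0 : e = 0.
  pose f : {scalar V} := HB.pack (B e) (GRing.isLinear.Build _ _ _ _ (B e) (isp_linearr BI e)).
  have [z [_ zu]] := isp_nondeg BI f.
  rewrite -(zu e)// -(zu 0)// => w; rewrite /= Be.
  by have := isp_linearl BI w (-1) 0 0; rewrite scaleN1r addr0 oppr0 /= mulN1r addNr.
have xE w : homog false w -> w = c1 w *: E1 + c2 w *: E2.
  move=> /homog_even w0; rewrite {1}(vec_split w) w0.
  by rewrite vec0 addr0.
rewrite (xE x hx) (xE y hy); apply: (br_span2_eq0 brB); rewrite ?brxx //.
by rewrite (br_skew_even brL h1 h2) -/e e0 oppr0.
Qed.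

(** The definition of [deformation] compares brackets of constant vectors only; bilinearity over
    K[[t]] extends the comparison to all vectors. *)
Lemma mod_t_br br0 : bilinear_op br0 -> deformation br0 br ->
  forall x y, mod_t (br x y) = br0 (mod_t x) (mod_t y).
Proof.
move=> br0B [_ def] x y.
rewrite (bilinear_op_expand brB) (bilinear_op_expand br0B).
rewrite -[LHS]/(map_mx (@ccoef0 K) _) raddf_sum; apply: eq_bigr => i _.
rewrite raddf_sum; apply: eq_bigr => j _.
rewrite /= map_mxZ rmorphM !mxE; congr (_ *: _).
by rewrite -def -!(map_bvec (@fpsC K)).
Qed.

(** A coordinate that survives modulo t is a unit of K[[t]] and can be cancelled. *)
Lemma unit_scale_eq0 a x i : a *: x = 0 -> ccoef0 (x 0 i) != 0 -> a = 0.
Proof.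
move=> /rowP/(_ i); rewrite !mxE => ax x0.
by apply: (@mulIr _ (x 0 i)); rewrite ?fps_unitE// mul0r.
Qed.

End MetricDeformation.

Definition eig4 (K : comNzRingType) (l : K) (i : 'I_4) : K :=
  nth 0 [:: 1; l; -1; - l] i.

Lemma diag4_eig (K : comNzRingType) (k : K) : diag4 k = diag_mx (\row_j eig4 k j).
Proof. by mx4_tac; rewrite ?mulr1n ?mulr0n. Qed.

(** * An odd eigenbasis for the action of e_2 *)

Section Eigenbasis.
Variables (K : fieldType) (br : 'rV[fps K]_(2 + 4) -> 'rV[fps K]_(2 + 4) -> 'rV[fps K]_(2 + 4)).
Variable l : K.
Hypotheses (two0 : 2%:R != 0 :> K) (l0 : l != 0) (l1 : l != 1) (lN1 : l != -1).
Local Notation A := (fps K).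
Local Notation V := 'rV[A]_(2 + 4).
Local Notation o4 k := (@Ordinal 4 k isT).
Implicit Types (x y z : V).
Hypothesis brL : lie_superalgebra br.
Hypothesis ab : forall x y, homog false x -> homog false y -> br x y = 0.
Hypothesis brmod : forall x y, mod_t (br x y) = dext (diag4 l) (mod_t x) (mod_t y).
Let brB : bilinear_op br := ls_bilinear brL.

(** Excluding 0, 1 and -1 for l, with 2 nonzero, keeps the four eigenvalues apart. *)
Lemma eig4_inj : injective (eig4 l).
Proof.
have u : uniq [:: 1; l; -1; - l].
  rewrite /= !inE !negb_or -!andbA andbT; apply/and5P; split=> //.
  - by rewrite eq_sym.
  - by rewrite -subr_eq0 opprK.
  - by rewrite -(inj_eq oppr_inj) opprK eq_sym.
  - rewrite eqr_opp [1 == l]eq_sym l1 andbT.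
    by rewrite -subr_eq0 opprK -mulr2n -mulr_natl mulf_neq0.
move=> i j /eqP; rewrite /eig4 nth_uniq// => /eqP; exact: val_inj.
Qed.

(** The index paired with j by [Om], which carries the opposite eigenvalue. *)
Definition star4 (j : 'I_4) : 'I_4 := inord ((j + 2) %% 4).

Lemma eig4_star j : eig4 l (star4 j) = - eig4 l j.
Proof.
by rewrite /eig4 /star4; case: j => -[|[|[|[|]]]] //= ?; rewrite inordK //= ?opprK.
Qed.

Lemma eig4_add i j : i != star4 j -> eig4 l i + eig4 l j != 0.
Proof. by rewrite addr_eq0 -eig4_star (inj_eq eig4_inj). Qed.

Local Notation E2 := (vec 0 1 0 : V).
Lemma even_E2 : homog false E2.
Proof. by apply/homog_even; rewrite vecE. Qed.

Lemma vecZ_odd (a : A) v : vec 0 0 (a *: v) = a *: vec 0 0 v.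
Proof. by apply: vecP; rewrite !coordE ?mulr0. Qed.

Lemma odd_vec (v : 'rV[A]_4) : homog true (vec 0 0 v).
Proof. by apply/homog_odd; rewrite !vecE. Qed.

Lemma odd_eta x : homog true x -> x = vec 0 0 (od x).
Proof. by move=> /homog_odd[x1 x2]; rewrite {1}[x]vec_eta x1 x2. Qed.

Lemma mod_t_vec (a b : A) v :
  mod_t (vec a b v) = vec (ccoef0 a) (ccoef0 b) (map_mx (@ccoef0 K) v).
Proof. by rewrite -[LHS]/(map_mx (@ccoef0 K) _) map_vec. Qed.

Lemma ad_E2 : exists2 M, forall v, br E2 (vec 0 0 v) = vec 0 0 (v *m M)
  & map_mx (@ccoef0 K) M = diag4 l.
Proof.
pose g (v : 'rV[A]_4) := od (br E2 (vec 0 0 v)).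
have gl : linear g.
  move=> a u v; rewrite /g -odZ -odD -(brZr brB) -(brDr brB); congr (od (br _ _)).
  by apply: vecP; rewrite !coordE ?mulr0 ?addr0.
pose gL : {linear 'rV[A]_4 -> 'rV[A]_4} := HB.pack g (GRing.isLinear.Build _ _ _ _ g gl).
have gE v : br E2 (vec 0 0 v) = vec 0 0 (v *m lin1_mx gL).
  rewrite mul_rV_lin1; apply: odd_eta.
  exact: (ls_even brL even_E2 (odd_vec v)).
exists (lin1_mx gL) => //; apply/row_matrixP => i; rewrite !rowE.
have := brmod E2 (vec 0 0 (delta_mx 0 i)); rewrite gE !mod_t_vec !rmorph0 rmorph1.
rewrite map_mx0 map_delta_mx /dext => /(congr1 (@od K)).
by rewrite !vecE scale1r scale0r subr0 map_mxM map_delta_mx.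
Qed.

Lemma eigenbasis : exists (v : 'I_4 -> 'rV[A]_4) (mu : 'I_4 -> A),
  [/\ forall i, br E2 (vec 0 0 (v i)) = mu i *: vec 0 0 (v i),
      forall i, map_mx (@ccoef0 K) (v i) = delta_mx 0 i
    & forall i, ccoef0 (mu i) = eig4 l i].
Proof.
have [M ME M0] := ad_E2; rewrite diag4_eig in M0.
have ex i : exists p : 'rV[A]_4 * A, [/\ p.1 *m M = p.2 *: p.1,
    map_mx (@ccoef0 K) p.1 = delta_mx 0 i & ccoef0 p.2 = eig4 l i].
  by have [v [mu [? ? ?]]] := eigenvector_lift eig4_inj M0 i; exists (v, mu).
have [p pP] := choice ex; exists (fun i => (p i).1), (fun i => (p i).2).
split=> i; have [vM v0 mu0] := pP i => //.
by rewrite ME vM vecZ_odd.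
Qed.

End Eigenbasis.

(** * Brackets of the eigenvectors *)

Section StructureConstants.
Variables (K : fieldType) (br : 'rV[fps K]_(2 + 4) -> 'rV[fps K]_(2 + 4) -> 'rV[fps K]_(2 + 4)).
Variable l : K.
Hypotheses (two0 : 2%:R != 0 :> K) (l0 : l != 0) (l1 : l != 1) (lN1 : l != -1).
Local Notation A := (fps K).
Local Notation V := 'rV[A]_(2 + 4).
Local Notation o4 k := (@Ordinal 4 k isT).
Local Notation E2 := (vec 0 1 0 : V).
Implicit Types (x y z : V).
Hypothesis brL : lie_superalgebra br.
Hypothesis ab : forall x y, homog false x -> homog false y -> br x y = 0.
Hypothesis brmod : forall x y, mod_t (br x y) = dext (diag4 l) (mod_t x) (mod_t y).
Let brB : bilinear_op br := ls_bilinear brL.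
Variables (v : 'I_4 -> 'rV[A]_4) (mu : 'I_4 -> A).
Let F i := vec 0 0 (v i).
Hypothesis adF : forall i, br E2 (F i) = mu i *: F i.
Hypothesis modv : forall i, map_mx (@ccoef0 K) (v i) = delta_mx 0 i.
Hypothesis modmu : forall i, ccoef0 (mu i) = eig4 l i.

Let hF i : homog true (F i). Proof. exact: odd_vec. Qed.
Let hFF i j : homog false (br (F i) (F j)).
Proof. exact: (ls_even brL (hF i) (hF j)). Qed.
Let hE2 : homog false E2. Proof. exact: even_E2. Qed.

(** The bracket of two odd vectors is even, so it commutes with [E2]; the Jacobi identity expands
    this vanishing bracket. *)
Lemma bracket_mu i j : (mu i + mu j) *: br (F i) (F j) = 0.
Proof.
have := br_jacobi_even brL (F j) hE2 (hF i); rewrite ab//.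
by rewrite !adF (brZl brB) (brZr brB) -scalerDl.
Qed.

(** Unless the eigenvalues are opposite modulo t, mu_i + mu_j has a nonzero constant term and can be
    inverted in [bracket_mu]. *)
Lemma bracket_eq0 i j : i != star4 j -> br (F i) (F j) = 0.
Proof.
move=> /(eig4_add two0 l0 l1 lN1) dij.
have u : mu i + mu j \is a GRing.unit by rewrite fps_unitE rmorphD /= !modmu.
by rewrite -[LHS]scale1r -(mulVr u) -scalerA bracket_mu scaler0.
Qed.

Lemma bracket_mod i j : mod_t (br (F i) (F j)) = vec ((diag4 l *m Om K) i j) 0 0.
Proof.
rewrite brmod !mod_t_vec !modv rmorph0 /dext !vecE !scale0r subr0; congr vec.
by rewrite /bform trmx_delta -rowE -colE !mxE.
Qed.

(** Conversely, a bracket that is nonzero modulo t cannot be killed by a nonzero scalar. *)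
Lemma bracket_mu_opp i j : (diag4 l *m Om K) i j != 0 -> mu i + mu j = 0.
Proof.
move=> nz; apply: (unit_scale_eq0 (bracket_mu i j) (i := lshift 4 ord0)).
have /(congr1 (@c1 K)) := bracket_mod i j.
by rewrite vecE /c1 mxE => E; rewrite /ccoef0 E.
Qed.

Let starE : [/\ star4 (o4 0) = o4 2, star4 (o4 1) = o4 3, star4 (o4 2) = o4 0
  & star4 (o4 3) = o4 1].
Proof. by split; apply: val_inj; rewrite /star4 /= inordK. Qed.

(** If i is p or q, then (ad F_i)^2 = 0, since twice it is the adjoint action of [F_i,F_i] = 0.
    Otherwise Jacobi moves F_i onto brackets that already vanish. *)
Lemma bracket_center i p q : i != star4 i -> p != star4 p -> q != star4 q ->
    [\/ i = p, i = q | i != star4 p /\ i != star4 q] ->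
  br (F i) (br (F p) (F q)) = 0.
Proof.
move=> /bracket_eq0 ii /bracket_eq0 pp /bracket_eq0 qq.
have self x : br (F i) (br (F i) x) = 0.
  by apply: (fps_addvv_eq0 two0); rewrite {1}(br_jacobi_odd brL)// ii (br0l brB) sub0r addNr.
case=> [ip|iq|[/bracket_eq0 ip /bracket_eq0 iq]].
- by rewrite -ip self.
- by rewrite (br_skew_odd brL (hF q) (hF p)) -iq self.
- by rewrite (br_jacobi_odd brL)// ip iq (br0l brB) (br0r brB) subr0.
Qed.

Let h := br (F (o4 0)) (F (o4 2)).
Let k := br (F (o4 1)) (F (o4 3)).

Let nstar i : i != star4 i.
Proof.
have [s0 s1 s2 s3] := starE.
by case: i => -[|[|[|[|]]]] //= i4; rewrite (bool_irrelevance i4 isT) ?s0 ?s1 ?s2 ?s3.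
Qed.

Lemma bracket_center02 i : br (F i) h = 0.
Proof.
apply: bracket_center; try exact: nstar.
have [s0 s1 s2 s3] := starE; rewrite s0 s2.
case: i => -[|[|[|[|]]]] //= i4; rewrite (bool_irrelevance i4 isT).
- by constructor 1.
- by constructor 3.
- by constructor 2.
- by constructor 3.
Qed.

(** The scalar a matches the e_1-coordinates of k and h, so k - a h is a multiple b of [E2]. Both k
    and h commute with the first eigenvector, on which [E2] acts by a unit; hence b = 0. *)
Lemma bracket_proportional : exists2 a, k = a *: h & ccoef0 a = l.
Proof.
have mh : mod_t h = vec 1 0 0 by rewrite bracket_mod diag4Om mxE.
have mk : mod_t k = vec l 0 0 by rewrite bracket_mod diag4Om mxE.
have h1 : ccoef0 (c1 h) = 1 by have /(congr1 (@c1 K)) := mh; rewrite vecE /c1 mxE.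
have k1 : ccoef0 (c1 k) = l by have /(congr1 (@c1 K)) := mk; rewrite vecE /c1 mxE.
have u1 : c1 h \is a GRing.unit by rewrite fps_unitE h1 oner_eq0.
pose a := c1 k / c1 h; exists a; last by rewrite rmorphM rmorphV//= h1 k1 divr1.
have odh : od h = 0 by apply/homog_even; exact: hFF.
have odk : od k = 0 by apply/homog_even; exact: hFF.
pose b := c2 k - a * c2 h.
have kE : k = a *: h + b *: E2.
  apply: vecP; rewrite !coordE ?odh ?odk ?scaler0 ?addr0 // ?mulr0 ?addr0.
    by rewrite divrK.
  by rewrite /b mulr1 addrC subrK.
have [s0 s1 s2 s3] := starE.
have : br (F (o4 0)) k = 0.
  by apply: bracket_center; try exact: nstar; rewrite s1 s3; constructor 3.
rewrite {1}kE (brDr brB) !(brZr brB) bracket_center02 scaler0 add0r.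
rewrite (br_skew_even brL hE2 (hF _)) adF -scaleNr scalerA => E.
have u0 : - mu (o4 0) \is a GRing.unit.
  by rewrite fps_unitE rmorphN /= modmu /eig4 /= oppr_eq0 oner_eq0.
suff b0 : b = 0 by rewrite {1}kE b0 scale0r addr0.
apply: (mulIr u0); rewrite mul0r.
apply: (unit_scale_eq0 E (i := rshift 2 (o4 0))).
have /rowP/(_ (o4 0)) := modv (o4 0).
by rewrite mxE row_mxEr => ->; rewrite mxE eqxx oner_eq0.
Qed.

Lemma structure_constants : exists h' a, [/\ ccoef0 a = l, mod_t h' = vec 1 0 0,
   homog false h', (forall i, br (F i) h' = 0) & forall i j, br (F i) (F j) = 
   (mx4 [:: [:: 0; 0; 1; 0]; [:: 0; 0; 0; a]; [:: 1; 0; 0; 0]; [:: 0; a; 0; 0]] : 'M[A]_4) i j *: h'].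
Proof.
have [a ka a0] := bracket_proportional; exists h, a; split=> //.
- by rewrite bracket_mod diag4Om mxE.
- exact: hFF.
- exact: bracket_center02.
have [s0 s1 s2 s3] := starE.
move=> -[[|[|[|[|]]]] //= i4] -[[|[|[|[|]]]] //= j4];
  rewrite (bool_irrelevance i4 isT) (bool_irrelevance j4 isT) mxE /= ?scale1r ?scale0r -?ka //;
  try by rewrite bracket_eq0 ?s0 ?s1 ?s2 ?s3.
- exact: br_skew_odd.
- exact: br_skew_odd.
Qed.

Lemma mu_opp : mu (o4 2) = - mu (o4 0) /\ mu (o4 3) = - mu (o4 1).
Proof.
by split; apply/eqP; rewrite -addr_eq0; apply/eqP; apply: bracket_mu_opp;
  rewrite diag4Om mxE //= oner_eq0.
Qed.

End StructureConstants.

(** The shape of the map [f] in the next lemma. Its even block is triangular because the image h of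
    e_1 under the inverse map may have an e_2-component. *)
Lemma triangular_linear (A : comNzRingType) (a b d : A) (P : 'M[A]_4) :
  linear (fun x => vec (c1 x * a) ((c2 x - c1 x * a * b) * d) (od x *m P)).
Proof.
move=> k x y; apply: vecP; rewrite !coordE; [ring | ring |].
by rewrite mulmxDl scalemxAl.
Qed.

(** * Normal form of a metric deformation *)

Section Uniqueness.
Variables (K : fieldType) (br : 'rV[fps K]_(2 + 4) -> 'rV[fps K]_(2 + 4) -> 'rV[fps K]_(2 + 4)).
Variable l : K.
Hypotheses (two0 : 2%:R != 0 :> K) (l0 : l != 0) (l1 : l != 1) (lN1 : l != -1).
Local Notation A := (fps K).
Local Notation V := 'rV[A]_(2 + 4).
Local Notation o4 k := (@Ordinal 4 k isT).
Local Notation E2 := (vec 0 1 0 : V).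

Lemma metric_deformation_diag4 : metric_deformation (dext (diag4 l)) br ->
  exists2 c, ccoef0 c = l & equivalent_def br (dext (diag4 c)).
Proof.
move=> [def [brL BI]].
have ab x y : homog false x -> homog false y -> br x y = 0.
  exact: (even_part_abelian two0 brL BI).
have brmod := mod_t_br brL (dext_bilinear _) def.
have brB := ls_bilinear brL.
have [v [mu [adF modv modmu]]] := eigenbasis two0 l0 l1 lN1 brL brmod.
have [h [a [a0 mh hh Fh FF]]] := structure_constants two0 l0 l1 lN1 brL ab brmod adF modv modmu.
have [mu2 mu3] := mu_opp l0 brL ab brmod adF modv.
have mu0 : ccoef0 (mu (o4 0)) = 1 by rewrite modmu.
have u0 : mu (o4 0) \is a GRing.unit by rewrite fps_unitE mu0 oner_eq0.
have ua : a \is a GRing.unit by rewrite fps_unitE a0.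
(* Dividing [E2] by its first eigenvalue normalizes the spectrum to 1, c, -1, -c. *)
pose c := mu (o4 1) / mu (o4 0).
have cl : ccoef0 c = l by rewrite rmorphM rmorphV//= mu0 modmu divr1.
(* Scaling the last eigenvector by c / a turns [F_4,F_6] = a h into c h, as the table of g^3(c)
   requires. The factor is 1 modulo t because c and a both reduce to l. *)
pose s (i : 'I_4) := if i == o4 3 then c / a else 1.
have s0 i : ccoef0 (s i) = 1.
  rewrite /s; case: ifP => _; rewrite ?rmorph1//.
  have -> : ccoef0 (c / a) = ccoef0 c / ccoef0 a by rewrite -rmorphV// -rmorphM.
  by rewrite cl a0 divff.
pose Q : 'M[A]_4 := \matrix_(i, j) (s i * v i 0 j).
pose T w : V := vec 0 0 (w *m Q).
pose F i : V := vec 0 0 (v i).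
have TE w : T w = \sum_i (w 0 i * s i) *: F i.
  rewrite /T -[RHS]/(\sum_i _) [LHS](_ : _ = vec 0 0 (\sum_i (w 0 i * s i) *: v i)); last first.
    congr vec; apply/rowP => j; rewrite mxE summxE; apply: eq_bigr => i _.
    by rewrite !mxE mulrA.
  elim/big_rec2: _ => [|i x y _ <-]; first exact: vec0.
  by apply: vecP; rewrite !coordE ?mulr0 ?addr0.
have hT w : homog true (T w) by exact: odd_vec.
have D_eig (w : 'rV[A]_4) i : mu (o4 0) * (w *m diag4 c) 0 i = mu i * w 0 i.
  rewrite diag4_eig mul_mx_diag !mxE mulrCA [RHS]mulrC; congr (_ * _).
  have cE : mu (o4 0) * c = mu (o4 1) by rewrite mulrC divrK.
  by case: i => -[|[|[|[|]]]] //= i4; rewrite /eig4 (bool_irrelevance i4 isT) /=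
    ?mulr1 ?mulrN ?mulr1 ?cE ?mu2 ?mu3.
have E2T w : br ((mu (o4 0))^-1 *: E2) (T w) = T (w *m diag4 c).
  rewrite (brZl brB) !TE (br_sumr brB) scaler_sumr; apply: eq_bigr => i _.
  rewrite (brZr brB) adF !scalerA; congr (_ *: _).
  have -> : (w *m diag4 c) 0 i = (mu (o4 0))^-1 * (mu i * w 0 i).
    by rewrite -D_eig mulKr.
  ring.
have TT w w' : br (T w) (T w') = bform (diag4 c *m Om A) w w' *: h.
  rewrite !TE (br_suml brB) formS scaler_suml; apply: eq_bigr => i _.
  rewrite (br_sumr brB) scaler_suml; apply: eq_bigr => j _.
  rewrite (brZl brB) (brZr brB) FF !scalerA; congr (_ *: _); rewrite diag4Om.
  have ac : c / a * a = c by rewrite divrK.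
  rewrite /s; move: (c / a) ac => q <-.
  case: i => -[|[|[|[|]]]] //= i4; case: j => -[|[|[|[|]]]] //= j4;
    rewrite (bool_irrelevance i4 isT) (bool_irrelevance j4 isT) !mxE /=; ring.
have hTr w : br (T w) h = 0.
  rewrite TE (br_suml brB) big1// => i _; by rewrite (brZl brB) Fh scaler0.
have hTl w : br h (T w) = 0.
  by apply/eqP; rewrite -oppr_eq0 -(br_skew_even brL hh (hT w)) hTr.
have modQ : map_mx (@ccoef0 K) Q = 1%:M.
  apply/matrixP => i j; have /rowP/(_ j) := modv i.
  by rewrite !mxE rmorphM /= s0 mul1r ?eqxx eq_sym => ->.
have uQ : Q \in unitmx by rewrite unitmxE fps_unitE -det_map_mx modQ det1 oner_eq0.
have modQV : map_mx (@ccoef0 K) (invmx Q) = 1%:M.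
  by rewrite -[LHS]mul1mx -{1}modQ -map_mxM mulmxV// map_mx1.
pose h1 := c1 h; pose h2 := c2 h; pose m := mu (o4 0).
have h10 : ccoef0 h1 = 1 by have /(congr1 (@c1 K)) := mh; rewrite vecE /c1 mxE.
have h20 : ccoef0 h2 = 0 by have /(congr1 (@c2 K)) := mh; rewrite vecE /c2 mxE.
have uh : h1 \is a GRing.unit by rewrite fps_unitE h10 oner_eq0.
(* The change of basis [g] goes from the normal form to [br]: e_1 goes to h, e_2 to the normalized
   [E2], and the odd basis to the rescaled eigenvectors. Its inverse [f] is the required
   equivalence, and the bracket identity is checked on [g]. *)
pose ev x : V := c1 x *: h + c2 x *: (m^-1 *: E2).
pose g x : V := ev x + T (od x).
pose f x : V := vec (c1 x / h1) ((c2 x - c1 x / h1 * h2) * m) (od x *m invmx Q).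
have hev x : homog false (ev x).
  apply/homog_even; rewrite !coordE (homog_even h).1//.
  by rewrite !scaler0 addr0.
have gf x : g (f x) = x.
  have odh : od h = 0 by apply/homog_even.
  apply: vecP; rewrite /g /ev /f /T !coordE -/h1 -/h2 ?odh ?scaler0 ?add0r.
  - by rewrite !mulr0 !addr0 divrK.
  - by rewrite !addr0 mulr1 mulrK// addrC subrK.
  - by rewrite mulmxKV.
have fg x : f (g x) = x.
  have odh : od h = 0 by apply/homog_even.
  apply: vecP; rewrite /g /ev /f /T !coordE -/h1 -/h2 ?odh ?scaler0 ?add0r.
  - by rewrite !mulr0 !addr0 mulrK.
  - by rewrite !mulr0 !addr0 mulrK// mulr1 addrC addKr mulrVK.
  - by rewrite mulmxK.
have evT x w : br (ev x) (T w) = c2 x *: T (w *m diag4 c).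
  by rewrite (brDl brB) !(brZl brB _ _ (T w)) hTl scaler0 add0r -E2T (brZl brB).
have gb x y : br (g x) (g y) = g (dext (diag4 c) x y).
  rewrite /g (brDl brB) (brDr brB (ev x)) (brDr brB (T _)).
  rewrite (ab _ _ (hev x) (hev y)) add0r evT TT.
  rewrite (br_skew_even brL (hev y) (hT _)) evT.
  have Tl b b' w w' : T (b *: w - b' *: w') = b *: T w - b' *: T w'.
    apply: vecP; rewrite !coordE ?mulr0 ?oppr0 ?addr0//.
    by rewrite mulmxBl !scalemxAl.
  rewrite /ev /dext !vecE Tl scale0r addr0 addrA addrC.
  by [].
(* Modulo t, h is e_1, m is 1 and Q is the identity, so [f] reduces to the identity. *)
exists c => //; exists f; last first.
  move=> x; rewrite /f mod_t_vec; apply: vecP; rewrite vecE /c1 /c2 /od.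
  - by rewrite rmorphM rmorphV//= h10 divr1 mxE.
  - by rewrite rmorphM rmorphB !rmorphM /= h20 mulr0 subr0 mu0 mulr1 mxE.
  - by rewrite map_mxM modQV mulmx1 map_rsubmx.
split.
- exact: triangular_linear.
- move=> [] x.
    by move=> /homog_odd[x1 x2]; apply/homog_odd; rewrite !vecE x1 x2 !mul0r subr0 mul0r.
  by move=> /homog_even x0; apply/homog_even; rewrite vecE x0 mul0mx.
- by move=> x y; rewrite -{1}(gf x) -{1}(gf y) gb fg.
Qed.

End Uniqueness.

(** * The family with parameter l + t *)

Section UniversalFamily.
Variable K : fieldType.
Implicit Types l : K.

Lemma diag4_family_deformation l :
  metric_deformation (g3_2_4 l) (pdext (diag4 (l%:P + 'X))).
Proof.
have := pdext_metric (diag4_sym (l%:P + 'X)).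
by rewrite map_diag4 /= /horner_eval !hornerE g3E.
Qed.

(** An equivalence has an odd block P with invertible diagonal, so the diagonal entries of D P = b P
    D' give b = 1 and then l + t = l, contradicted by the coefficient of t. *)
Lemma diag4_family_nontrivial l : l != 0 ->
  ~ trivial_def (g3_2_4 l) (pdext (diag4 (l%:P + 'X))).
Proof.
move=> l0; rewrite /trivial_def g3E map_bracket_dext /pdext !map_diag4.
move=> [f /dext_hom_odd[b [P [DP fP]]] fmod].
have P1 i : P i i \is a GRing.unit.
  have := fmod (vec 0 0 (delta_mx 0 i)); rewrite fP !mod_t_vec => /(congr1 (@od K)).
  rewrite !vecE -rowE => /rowP/(_ i); rewrite !mxE !eqxx fps_unitE => ->.
  by rewrite rmorph1 oner_eq0.
have DPi i : eig4 (fps_of_poly (l%:P + 'X)) i = b * eig4 (fpsC l) i.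
  have := congr1 (fun M : 'M_4 => M i i) DP; rewrite !diag4_eig mul_diag_mx mul_mx_diag !mxE.
  by rewrite [P i i * _]mulrC mulrA => /(mulIr (P1 i)).
have := DPi (@Ordinal 4 0 isT); rewrite /eig4 /= mulr1 => b1.
have := DPi (@Ordinal 4 1 isT); rewrite /eig4 /= -b1 mul1r.
move=> /(congr1 (fun u => fpscoef u 1)).
by rewrite /= coefD coefC coefX add0r => /eqP; rewrite oner_eq0.
Qed.

(** The normal form has parameter c with constant term l, and u = c - l is the substitution that
    turns l + t into c. *)
Lemma diag4_family_universal l : (2%:R : K) != 0 -> l != 0 -> l != 1 -> l != -1 ->
  unique_up_to_equiv_and_param (g3_2_4 l) (pdext (diag4 (l%:P + 'X))).
Proof.
move=> two0 l0 l1 lN1 br; rewrite g3E => /(metric_deformation_diag4 two0 l0 l1 lN1).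
move=> [c cl eq_c] _; have u0 : ccoef0 (c - fpsC l) = 0.
  by rewrite rmorphB /= cl ?ccoef0C subrr.
exists (c - fpsC l) => //; rewrite (pdext_reparam _ u0).
pose phi : {rmorphism {poly K} -> fps K} :=
  horner_eval (c - fpsC l) \o map_poly (@fpsC K).
rewrite -[map_mx _ _]/(map_mx phi _) map_diag4 /= /horner_eval rmorphD /=.
by rewrite map_polyC map_polyX hornerD hornerC hornerX addrC subrK.
Qed.

End UniversalFamily.

Theorem theorem3p4p3 (R : realType) :
  (forall l : R[i], l != 0 -> l != 1 -> l != -1 ->
     exists brt, [/\ metric_deformation (g3_2_4 l) brt,
       ~ trivial_def (g3_2_4 l) brt,
       unique_up_to_equiv_and_param (g3_2_4 l) brt
       & smooth_around_itself l brt])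
  /\
  (isometrically_isomorphic (g3_2_4 (1 : R[i])) (g3_2_4 (-1 : R[i])) /\
   forall l : R[i], l = 1 \/ l = -1 ->
     (exists2 brt, metric_deformation (g3_2_4 l) brt
        & smooth_around_itself l brt) /\
     (exists2 brt, metric_deformation (g3_2_4 l) brt
        & jump_deformation (g3_2_4 l) brt (@g4_2_4 R[i]))).
Proof.
split=> [l l0 l1 lN1|].
  exists (pdext (diag4 (l%:P + 'X))); split.
  - exact: diag4_family_deformation.
  - exact: diag4_family_nontrivial.
  - exact: diag4_family_universal (two_neq0 R) l0 l1 lN1.
  - exact: diag4_smooth.
split; first by have := diag4_isometricN (-1 : R[i]); rewrite opprK -!g3E.
move=> l l_pm1; split.
  exists (pdext (diag4 (l%:P + 'X))); first exact: diag4_family_deformation.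
  by apply: diag4_smooth; case: l_pm1 => ->; rewrite ?oppr_eq0 oner_eq0.
(* The nilpotent term must commute with the undeformed matrix, whence a different family for each
   sign; both have all nonzero fibres isomorphic to g^4. *)
case: l_pm1 => ->.
- exists (pdext (jordan 'X)).
    have := pdext_metric (jordan_sym ('X : {poly R[i]})).
    by rewrite map_jordan /= /horner_eval hornerX jordan0 g3E.
  apply: jordan_jump; first by rewrite expr1n.
  by move=> z z0; rewrite map_jordan /= /horner_eval hornerX; exact: jordan_iso.
- exists (pdext (jordanN 'X)).
    have := pdext_metric (jordanN_sym ('X : {poly R[i]})).
    by rewrite map_jordanN /= /horner_eval hornerX jordanN0 g3E.
  apply: jordan_jump; first by rewrite sqrrN expr1n.
  move=> z z0; rewrite map_jordanN /= /horner_eval hornerX.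
  exact: lie_isomorphic_trans (jordanN_iso z) (jordan_iso z0).
Qed.
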